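(* There exists a family $\{f_\beta : \beta < \mathfrak{c}\}$ of Hamel bijections $f_\beta\colon \mathbb{R}\to\mathbb{R}$ (indexed by the ordinals $\beta<\mathfrak{c}$) such that the $f_\beta$ are free generators of a group with respect to composition of functions, and all elements of this group other than the identity function $\mathrm{id}_{\mathbb{R}}$ are also Hamel bijections.
   Context: $\mathfrak{c}$ denotes the cardinality of the continuum, identified with the corresponding initial ordinal. A Hamel basis of $\mathbb{R}^2$ is a set $B\subset\mathbb{R}^2$ that is a basis of $\mathbb{R}^2$ as a linear space over $\mathbb{Q}$. A function $f\colon\mathbb{R}\to\mathbb{R}$ is a Hamel function if its graph $\{\langle x,f(x)\rangle : x\in\mathbb{R}\}\subset\mathbb{R}^2$ is a Hamel basis of $\mathbb{R}^2$. A Hamel bijection is a Hamel function that is a bijection of $\mathbb{R}$ onto $\mathbb{R}$. That the $f_\beta$, $\beta<\mathfrak{c}$, are free generators of a group means that the subgroup they generate in the group of all bijections of $\mathbb{R}$ under composition is free with the $f_\beta$ as free generators indexed by $\beta<\mathfrak{c}$ (in particular $f_\alpha\neq f_\beta$ for $\alpha\ne\beta$, so there are continuum many generators): every element of the group has a unique representation, up to trivial variations (i.e. a unique reduced form), as a product of finitely many integer powers of the generators. *)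

(* Defs.v *)
(* MathComp-Analysis *)
From HB Require Import structures.
From mathcomp Require Import all_boot all_order all_algebra finmap.
From mathcomp Require Import wochoice boolp classical_sets functions.
From mathcomp Require Import cardinality reals.

Set Implicit Arguments.
Unset Strict Implicit.
Unset Printing Implicit Defensive.

Import Order.TTheory GRing.Theory Num.Theory.

Local Open Scope classical_set_scope.
Local Open Scope ring_scope.

(* A real vector space V is regarded as a rational one by letting q : rat act
   as the scalar ratr q. *)
Section RationalBasis.
Variables (R : realType) (V : lmodType R).
Implicit Types (B : set V) (s : {fset V}) (c : V -> rat).

Definition ratcomb s c : V := \sum_(v <- s) ratr (c v) *: v.

Definition ratfree B : Prop :=
  forall s c, [set` s] `<=` B -> ratcomb s c = 0 -> {in s, forall v, c v = 0}.

Definition ratspan B : set V :=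
  [set w | exists s c, [set` s] `<=` B /\ w = ratcomb s c].

Definition hamel_basis B : Prop := ratfree B /\ ratspan B = setT.

End RationalBasis.

(* R^o is R as a vector space over itself, so R^o * R^o is the plane. *)
Definition graph_of (R : realType) (f : R -> R) : set (R^o * R^o) :=
  [set p | p.2 = f p.1].

Definition hamel_function (R : realType) (f : R -> R) : Prop :=
  hamel_basis (graph_of f).

Definition hamel_bijection (R : realType) (f : R -> R) : Prop :=
  hamel_function f /\ bijective f.

Section BijectionGroup.
Variable T : Type.

Record bijection := Bijection { bij_fun :> T -> T; bij_funP : bijective bij_fun }.

HB.instance Definition _ := gen_eqMixin bijection.
HB.instance Definition _ := gen_choiceMixin bijection.

Lemma bijection_eqP (f g : bijection) : f =1 g -> f = g.
Proof.
case: f g => [f fP] [g gP] /= /funext fg; move: gP; rewrite -fg => gP.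
by rewrite (Prop_irrelevance fP gP).
Qed.

Lemma bijection_inv_subproof (f : bijection) :
  {g : T -> T | cancel f g /\ cancel g f}.
Proof. by apply: cid; case: (bij_funP f) => g fK gK; exists g. Qed.

Definition bijection_inv (f : bijection) : bijection :=
  let: exist g (conj fK gK) := bijection_inv_subproof f in
  Bijection (Bijective gK fK).

Definition bijection_one : bijection := @Bijection id (inv_bij (fun=> erefl)).

Definition bijection_mul (f g : bijection) : bijection :=
  Bijection (bij_comp (bij_funP f) (bij_funP g)).

Lemma bijection_mulA : associative bijection_mul.
Proof. by move=> f g h; apply: bijection_eqP. Qed.

Lemma bijection_mul1 : left_id bijection_one bijection_mul.
Proof. by move=> f; apply: bijection_eqP. Qed.

Lemma bijection_mulr1 : right_id bijection_one bijection_mul.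
Proof. by move=> f; apply: bijection_eqP. Qed.

Lemma bijection_mulV : left_inverse bijection_one bijection_inv bijection_mul.
Proof.
move=> f; apply: bijection_eqP => x; rewrite /bijection_inv /=.
by case: (bijection_inv_subproof f) => g [fK gK]; exact: fK.
Qed.

Lemma bijection_mulrV : right_inverse bijection_one bijection_inv bijection_mul.
Proof.
move=> f; apply: bijection_eqP => x; rewrite /bijection_inv /=.
by case: (bijection_inv_subproof f) => g [fK gK]; exact: gK.
Qed.

(* (f * g)%g is the composite f \o g. *)
HB.instance Definition _ := isGroup.Build bijection
  bijection_mulA bijection_mul1 bijection_mulr1 bijection_mulV bijection_mulrV.

End BijectionGroup.

Section FreeGenerators.
Variables (G : groupType) (I : eqType) (x : I -> G).

Definition expgz (g : G) (k : int) : G :=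
  match k with Posz n => (g ^+ n)%g | Negz n => (g ^- n.+1)%g end.

Definition generated : set G :=
  smallest [set H : set G |
    [/\ H 1%g, forall g h, H g -> H h -> H (g * h)%g & forall g, H g -> H g^-1%g]]
  (range x).

(* The word [:: (i1, k1); ...; (in, kn)] stands for x i1 ^ k1 * ... * x in ^ kn;
   it is reduced if all kj are nonzero and neighbouring ij are distinct. *)
Definition word_eval (w : seq (I * int)) : G :=
  (\prod_(p <- w) expgz (x p.1) p.2)%g.

Definition reduced (w : seq (I * int)) : bool :=
  all (fun p => p.2 != 0) w && sorted (fun p q => p.1 != q.1) w.

Definition free_generators : Prop :=
  forall g, generated g -> exists! w, reduced w /\ word_eval w = g.

End FreeGenerators.

(* (C, le) represents the initial ordinal of cardinality continuum, an ordinal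
   being identified with the well-ordered set of smaller ordinals. *)
Definition is_continuum_ordinal (R : realType) (C : eqType) (le : rel C) : Prop :=
  [/\ wochoice.well_order le,
      ([set: C] #= [set: R])%card &
      forall b : C, ~~ ([set a : C | le a b && (a != b)] #= [set: R])%card].

Lemma continuum_ordinal_exists (R : realType) :
  exists (C : eqType) (le : rel C), is_continuum_ordinal R le.
Proof.
have [le le_wo] := well_ordering_principle R.
pose seg (b : R) := [set a : R | le a b && (a != b)].
have le_chain : wo_chain le predT by move=> A _; exact: le_wo.
have [[b0 b0P]|small] := pselect (exists b, (seg b #= [set: R])%card); last first.
  by exists R, le; split=> // b; apply/negP => segb; apply: small; exists b.
have anti x y : le x y -> le y x -> x = y.
  by move=> xy yx; apply: (wo_chain_antisymmetric le_chain) => //; rewrite xy.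
have tot x y : le x y || le y x by exact: (wo_chainW le_chain).
have trans x y z : le x y -> le y z -> le x z.
  move=> xy yz; pose A : {pred R} := [pred t | t \in [:: x; y; z]].
  have Ane : wochoice.nonempty A by exists x; rewrite !inE eqxx.
  have [m [[Am mP] _]] := le_wo A Ane.
  have mx : le m x by apply: mP; rewrite !inE eqxx.
  have my : le m y by apply: mP; rewrite !inE eqxx orbT.
  have mz : le m z by apply: mP; rewrite !inE eqxx !orbT.
  move: Am; rewrite !inE => /or3P[] /eqP mE; subst m.
  - exact: mz.
  - by rewrite (anti _ _ xy mx).
  - by rewrite -(anti _ _ yz my).
pose D : {pred R} := [pred b | (seg b #= [set: R])%card].
have Dne : wochoice.nonempty D by exists b0.
have [m [[Dm mP] _]] := le_wo D Dne.
pose P : pred R := fun x => le x m && (x != m).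
pose S : eqType := {x : R | P x}.
have le_wo' : wochoice.well_order (fun a b : S => le (sval a) (sval b)).
  move=> A [a Aa].
  pose B : {pred R} := [pred r | `[< exists2 s : S, s \in A & sval s = r >]].
  have Bne : wochoice.nonempty B by exists (sval a); apply/asboolP; exists a.
  have [r [[/asboolP[s As sr] rP] _]] := le_wo B Bne; subst r.
  have sP t : t \in A -> le (sval s) (sval t).
    by move=> At; apply: rP; apply/asboolP; exists t.
  exists s; split=> [//|t [At tP]].
  by apply: val_inj; apply: anti; [exact: sP|exact: tP].
have valC (X : set S) : ((fun x : S => sval x) @` X #= X)%card.
  by apply: inj_card_eq => ? ? _ _; exact: val_inj.
exists S, (fun a b => le (sval a) (sval b)); split=> //.
- apply: card_eq_trans (Dm : (seg m #= [set: R])%card).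
  rewrite card_eq_sym; have -> : seg m = (fun x : S => sval x) @` setT.
    apply/seteqP; split=> [r rm|_ [[s sm] _ <-]] //.
    by exists (exist _ r rm).
  exact: valC.
- move=> b; apply/negP => segb.
  have /andP[bm /negP] := svalP b; apply; apply/eqP/anti => //.
  apply: mP; suff: (seg (sval b) #= [set: R])%card by []; apply: card_eq_trans segb.
  have -> : seg (sval b) =
      (fun x : S => sval x) @` [set a : S | le (sval a) (sval b) && (a != b)].
    apply/seteqP; split=> [r /andP[rb rNb]|_ [s /andP[sb sNb] <-]]; last first.
      by rewrite /seg /= sb.
    have rm : P r.
      apply/andP; split; first exact: trans rb bm.
      by apply/eqP => rE; subst r; move: rNb; rewrite (anti _ _ rb bm) eqxx.
    by exists (exist _ r rm); rewrite //= rb.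
  exact: valC.
Qed.

(* Main.v *)
(* Let F be a free group on continuum many generators, let X be a free F-set with
   continuum many orbits, and M = Q[X].  It suffices to find a rational subspace
   K of M such that
   - M is the direct sum of K and wK for every w <> 1 in F, and
   - every coset of K contains exactly one element of X.
   Indeed X is then identified with M/K, which as a rational space is isomorphic
   to R, and F acts on R through X.  For w <> 1 the graph of w is the image of X
   under Q[X] -> (M/K)^2, m |-> (m, wm), and this map has kernel the
   intersection of K and w^-1 K and is onto as K + w^-1 K = M.
   K is built by transfinite recursion.  To put m in K + wK one adds the relations
   u and m - wu, where u = x + y with x, y in two orbits not used so far; to put an
   element of X in the coset of m one adds m - x with x in an unused orbit.  A
   relation is added only if the requirement it serves is not yet met, which is
   what keeps the sum direct and the elements of X inequivalent.  The case of m in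
   K + wK uses that F has no element of order two.
   Orbits are indexed by R * nat * bool, and the task attached to (r, n) involves
   only orbits of rank below n: fresh orbits are available without any counting. *)
Require Import Defs.
From HB Require Import structures.
From mathcomp Require Import all_boot all_order all_algebra finmap.
From mathcomp Require Import wochoice boolp classical_sets functions.
From mathcomp Require Import cardinality reals.
From mathcomp Require Import lra ring zify.

Set Implicit Arguments.
Unset Strict Implicit.
Unset Printing Implicit Defensive.

Import Order.TTheory GRing.Theory Num.Theory.

Local Open Scope classical_set_scope.
Local Open Scope ring_scope.

(** * Well-founded relations *)

Section WellFounded.
Variables (T : Type) (lt : T -> T -> Prop).
Hypothesis lt_wf : well_founded lt.

Lemma wf_irr s : ~ lt s s.
Proof. by elim: (lt_wf s) => t _ IH /[dup]/IH. Qed.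

Lemma wf_asym s t : lt s t -> ~ lt t s.
Proof.
by elim: (lt_wf s) t => {}s _ IH t st ts; exact: (IH t ts s).
Qed.

Lemma wf_no_cycle3 s t u : lt s t -> lt t u -> ~ lt u s.
Proof.
elim: (lt_wf s) t u => {}s _ IH t u st tu us.
exact: (IH u us s t).
Qed.

(** Besides [lt s u], trichotomy leaves only a cycle of length two or three, and well-foundedness
    excludes both. *)
Lemma wf_total_trans : (forall s t, [\/ lt s t, s = t | lt t s]) ->
  forall s t u, lt s t -> lt t u -> lt s u.
Proof.
move=> lt_total s t u st tu; have [//|su|us] := lt_total s u.
  by rewrite su in st; case: (wf_asym st tu).
by case: (wf_no_cycle3 st tu us).
Qed.

End WellFounded.

(** * Rational linear combinations *)

Section LinearCombinations.
Variable V : lmodType rat.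
Implicit Types (K G : set V).

(** With combinations as lists, addition is concatenation and proofs go by induction on the list. *)
Definition lin (J : Type) (v : J -> V) (l : seq (rat * J)) : V :=
  \sum_(p <- l) p.1 *: v p.2.

Definition coef (J : eqType) (l : seq (rat * J)) (j : J) : rat :=
  \sum_(p <- l | p.2 == j) p.1.

Definition scale_comb (J : Type) (a : rat) (l : seq (rat * J)) :=
  [seq (a * p.1, p.2) | p <- l].

Lemma lin_nil J (v : J -> V) : lin v [::] = 0.
Proof. exact: big_nil. Qed.

Lemma lin_cons J (v : J -> V) p l : lin v (p :: l) = p.1 *: v p.2 + lin v l.
Proof. exact: big_cons. Qed.

Lemma lin_cat J (v : J -> V) l l' : lin v (l ++ l') = lin v l + lin v l'.
Proof. exact: big_cat. Qed.

Lemma lin_scale J (v : J -> V) a l : lin v (scale_comb a l) = a *: lin v l.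
Proof.
by rewrite /lin big_map scaler_sumr; apply: eq_bigr => p _; rewrite scalerA.
Qed.

Lemma coef_scale (J : eqType) a (l : seq (rat * J)) j :
  coef (scale_comb a l) j = a * coef l j.
Proof. by rewrite /coef big_map mulr_sumr. Qed.

Lemma lin_coef (J : eqType) (v : J -> V) (l : seq (rat * J)) (s : seq J) :
  uniq s -> {in l, forall p, p.2 \in s} ->
  lin v l = \sum_(j <- s) coef l j *: v j.
Proof.
move=> us ls.
have -> : \sum_(j <- s) coef l j *: v j =
    \sum_(j <- s) \sum_(p <- l | p.2 == j) p.1 *: v j.
  by apply: eq_bigr => j _; rewrite scaler_suml.
rewrite (exchange_big_dep predT) //= /lin big_seq [RHS]big_seq.
apply: eq_bigr => p lp; under eq_bigl do rewrite eq_sym.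
by rewrite -big_filter filter_pred1_uniq ?big_seq1 ?ls.
Qed.

Lemma lin_coef0 (J : eqType) (v : J -> V) (l : seq (rat * J)) :
  (forall j, coef l j = 0) -> lin v l = 0.
Proof.
move=> l0; rewrite (@lin_coef _ v l (undup (map snd l))) ?undup_uniq //.
  by rewrite big1 // => j _; rewrite l0 scale0r.
by move=> p lp; rewrite mem_undup map_f.
Qed.

Definition subspace K := K 0 /\ forall a x y, K x -> K y -> K (a *: x + y).

Section Subspace.
Variables (K : set V) (subK : subspace K).

Lemma subspaceD x y : K x -> K y -> K (x + y).
Proof. by move=> Kx Ky; rewrite -[x]scale1r; apply: subK.2. Qed.

Lemma subspaceZ a x : K x -> K (a *: x).
Proof. by move=> Kx; rewrite -[_ *: _]addr0; apply: subK.2 => //; exact: subK.1. Qed.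

Lemma subspaceN x : K x -> K (- x).
Proof. by rewrite -scaleN1r; exact: subspaceZ. Qed.

Lemma subspaceB x y : K x -> K y -> K (x - y).
Proof. by move=> Kx Ky; apply: subspaceD => //; exact: subspaceN. Qed.

Lemma subspaceZ_inv a x : a != 0 -> K (a *: x) -> K x.
Proof. by move=> a0 /(subspaceZ a^-1); rewrite scalerA mulVf // scale1r. Qed.

End Subspace.

Definition linspan G : set V :=
  [set w | exists l : seq (rat * V), {in l, forall p, G p.2} /\ w = lin id l].

Lemma subspace_linspan G : subspace (linspan G).
Proof.
split=> [|a _ _ [l [Gl ->]] [l' [Gl' ->]]].
  by exists [::]; rewrite lin_nil.
exists (scale_comb a l ++ l'); split; last by rewrite lin_cat lin_scale.
by move=> p; rewrite mem_cat => /orP[/mapP[q lq ->]|/Gl' //]; exact: (Gl q).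
Qed.

Lemma sub_linspan G x : G x -> linspan G x.
Proof.
move=> Gx; exists [:: (1, x)]; split=> [p|]; first by rewrite inE => /eqP ->.
by rewrite /lin big_seq1 scale1r.
Qed.

Lemma linspan_sub G K : subspace K -> G `<=` K -> linspan G `<=` K.
Proof.
move=> subK GK _ [l [Gl ->]]; elim: l Gl => [|p l IH] Gl.
  by rewrite lin_nil; exact: subK.1.
rewrite lin_cons; apply: subK.2; first by apply/GK/Gl; rewrite mem_head.
by apply: IH => q lq; apply: Gl; rewrite inE lq orbT.
Qed.

Lemma linspan_subset G G' : G `<=` G' -> linspan G `<=` linspan G'.
Proof.
move=> GG'; apply: linspan_sub (subspace_linspan _) _ => x /GG'.
exact: sub_linspan.
Qed.

Section Basis.
Variables (J : choiceType) (v : J -> V).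

(* Combinations are lists in which an index may be repeated: independence has to
   be stated for the collected coefficients. *)
Definition free_mod K (B : set J) :=
  forall l, {in l, forall p, B p.2} -> K (lin v l) -> forall j, coef l j = 0.

(** Zorn's lemma: a maximal family that is free modulo [K] also spans modulo [K]. It is used twice,
    for a basis of the quotient by [K] and, with [K = 0], for a Hamel basis of the reals. *)
Lemma maximal_free K A : subspace K -> free_mod K A ->
  exists B : set J, [/\ A `<=` B, free_mod K B &
    forall j, exists l, {in l, forall p, B p.2} /\ K (v j - lin v l)].
Proof.
move=> subK freeA.
have [|B [freeB maxB]] := @Zorn_bigcup J [set B | free_mod K (A `|` B)].
  move=> C CP Ctot l lC Kl.
  suff [Z [Zfree lZ]] : exists Z, free_mod K Z /\ {in l, forall p, Z p.2}.
    exact: Zfree.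
  (* A combination has finitely many indices, so one member of the chain contains all those outside
     [A]. The empty set is allowed as well, since the chain may be empty. *)
  have [Z [ZC lZ]] : exists Z, (Z = set0 \/ C Z) /\
      {in l, forall p, (A `|` Z) p.2}.
    elim: l lC {Kl} => [|p l IH] lC; first by exists set0; split=> //; left.
    have [|Z [ZC lZ]] := IH; first by move=> q lq; apply: lC; rewrite inE lq orbT.
    have [Ap|[Y CY Yp]] := lC p (mem_head _ _).
      exists Z; split=> // q; rewrite inE => /predU1P[->|/lZ //]; first by left.
    case: ZC => [Z0|CZ].
      exists Y; split; first by right.
      move=> q; rewrite inE => /predU1P[->|/lZ]; first by right.
      by rewrite Z0 setU0; left.
    have [ZY|YZ] := Ctot _ _ CZ CY.
      exists Y; split; first by right.
      move=> q; rewrite inE => /predU1P[->|/lZ[]]; [by right|by left|].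
      by move=> /ZY; right.
    exists Z; split; first by right.
    by move=> q; rewrite inE => /predU1P[->|/lZ //]; right; exact: YZ.
  exists (A `|` Z); split=> //; case: ZC => [->|/CP //].
  by rewrite setU0.
exists (A `|` B); split=> [i|//|j]; first by left.
have [Bj|nBj] := pselect ((A `|` B) j).
  exists [:: (1, j)]; split=> [p|]; first by rewrite inE => /eqP ->.
  by rewrite /lin big_seq1 scale1r subrr; exact: subK.1.
have := maxB (j |` B); rewrite /mkset => nfree.
have {}nfree : ~ free_mod K (A `|` (j |` B)).
  apply: nfree; split; first by move=> i; right.
  by move=> /(_ j (or_introl erefl)) Bj; apply: nBj; right.
(* If [v j] is not spanned, then [j] can be adjoined: a nonzero coefficient of [j] in a relation
   could be divided out, which would express [v j] through the others. *)
apply: contrapT => nspan; apply: nfree => l lB Kl.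
pose l' := [seq p <- l | p.2 != j].
have l'B : {in l', forall p, (A `|` B) p.2}.
  move=> p; rewrite mem_filter => /andP[pj /lB[|[/eqP|]]]; first by left.
    by rewrite (negPf pj).
  by right.
have linE : lin v l = coef l j *: v j + lin v l'.
  rewrite /lin (bigID (fun p => p.2 == j)) /= big_filter; congr (_ + _).
  rewrite scaler_suml; apply: eq_bigr => p /eqP -> //.
have lj : coef l j = 0.
  apply/eqP/negPn/negP => lj0; apply: nspan.
  exists (scale_comb (- (coef l j)^-1) l'); split.
    by move=> _ /mapP[q lq ->]; exact: (l'B q).
  rewrite lin_scale scaleNr opprK; apply: (subspaceZ_inv subK lj0).
  by rewrite scalerDr scalerA mulfV // scale1r -linE.
rewrite linE lj scale0r add0r in Kl.
move=> i; have [->//|ij] := eqVneq i j.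
rewrite -(freeB _ l'B Kl i) /coef big_filter_cond; apply: eq_bigl => p.
by have [->|//] := eqVneq p.2 i; rewrite ?ij ?andbF.
Qed.

End Basis.
End LinearCombinations.

(** * The subspace K *)

Section FreeModule.
Variables (F : groupType) (J : choiceType).
Local Notation X := (F * J)%type.
Local Notation M := (X -> rat^o).
Implicit Types (k m : M) (x y : X) (w : F).

(** [M] consists of all functions on [X]; the module Q[X] is the span of the [delta x], and its
    elements are given as [lin delta l]. *)
Definition delta x : M := fun y => (y == x)%:R.

Definition act w x : X := ((w * x.1)%g, x.2).

Definition shift w k : M := fun x => k (act w^-1%g x).

Lemma act1 x : act 1%g x = x.
Proof. by case: x => g j; rewrite /act mul1g. Qed.

Lemma actM w w' x : act (w * w')%g x = act w (act w' x).
Proof. by rewrite /act mulgA. Qed.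

Lemma shift1 k : shift 1%g k = k.
Proof. by apply/funext => x; rewrite /shift invg1 act1. Qed.

Lemma shiftM w w' k : shift (w * w')%g k = shift w (shift w' k).
Proof. by apply/funext => x; rewrite /shift invgM actM. Qed.

Lemma shiftK w : cancel (shift w) (shift w^-1%g).
Proof. by move=> k; rewrite -shiftM mulVg shift1. Qed.

Lemma shiftD w k k' : shift w (k + k') = shift w k + shift w k'.
Proof. by []. Qed.

Lemma shiftZ w a k : shift w (a *: k) = a *: shift w k.
Proof. by []. Qed.

Lemma shift_delta w x : shift w (delta x) = delta (act w x).
Proof.
apply/funext => y; rewrite /shift /delta; congr (_%:R); congr nat_of_bool.
by apply/eqP/eqP => [<-|->]; rewrite -actM ?mulVg ?mulgV act1.
Qed.

Lemma shift_lin w (l : seq (rat * X)) :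
  shift w (lin delta l) = lin delta [seq (p.1, act w p.2) | p <- l].
Proof.
elim: l => [|p l IH]; first by rewrite !lin_nil.
by rewrite /= !lin_cons shiftD shiftZ shift_delta IH.
Qed.

Lemma lin_delta (l : seq (rat * X)) : lin delta l = coef l.
Proof.
apply/funext => x; elim: l => [|p l IH]; first by rewrite /lin /coef !big_nil.
transitivity (p.1 * (x == p.2)%:R + lin delta l x).
  by rewrite lin_cons.
rewrite IH /coef big_cons eq_sym.
by case: eqP => _; rewrite ?mulr1 ?mulr0 ?add0r.
Qed.

End FreeModule.

(** * Admissible subspaces and their one-step extensions *)

Section Kernel.
Variables (F : groupType) (I : choiceType).
Hypothesis no2 : forall w : F, (w * w = 1 -> w = 1)%g.
Local Notation X := (F * (I * bool))%type.
Local Notation M := (X -> rat^o).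
Implicit Types (K : set M) (k m : M) (x y : X) (w : F) (t : I).

(* The third condition says that the elements of X in the orbits (t, true) stay
   linearly independent modulo K, so that M/K has dimension continuum. *)
Definition good K :=
  [/\ forall w k k', w <> 1%g -> K k -> K k' -> k = shift w k' -> k = 0,
      forall x y, K (delta x - delta y) -> x = y &
      forall k, K k -> (forall g t, k (g, (t, false)) = 0) -> k = 0].

Definition fresh t k := forall g b, k (g, (t, b)) = 0.

Lemma good0 : good [set 0].
Proof.
split=> //= x y /(congr1 (fun f : M => f x)).
have -> : (delta x - delta y) x = 1 - (x == y)%:R 
    by transitivity ((x == x)%:R - (x == y)%:R : rat); rewrite // eqxx.
case: (x =P y) => // _; rewrite subr0 => /eqP; rewrite oner_eq0.
Qed.

Definition extend1 K r : set M := [set k | exists k0 a, K k0 /\ k = k0 + a *: r].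

Definition extend2 K r r' : set M :=
  [set k | exists k0 a b, K k0 /\ k = k0 + a *: r + b *: r'].

Definition base t : X := (1%g, (t, false)).

(** The coefficient of the new relation can be read off at [base t], as [K] and [m] vanish on the
    orbits of [t]. Comparing [k = w k'] at 1 and at [w] kills both coefficients. A difference of two
    points involves the relation only if one of them is [base t]; then [m - delta y] lies in [K] for
    the other point [y], against the hypothesis. *)
Lemma good_extend1 K t m : subspace K -> good K ->
  (forall k, K k -> fresh t k) -> fresh t m ->
  (forall y, ~ K (m - delta y)) -> good (extend1 K (m - delta (base t))).
Proof.
move=> subK [K1 K2 K3] fK fm mK.
have ev k a g : K k ->
    (k + a *: (m - delta (base t))) (g, (t, false)) = - a * (g == 1%g)%:R.
  move=> Kk; transitivity (k (g, (t, false)) +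
    a * (m (g, (t, false)) - ((g, (t, false)) == base t)%:R)); first by [].
  by rewrite fK // fm xpair_eqE eqxx andbT add0r sub0r mulrN mulNr.
split.
- move=> w _ _ /eqP w1 [k [a [Kk ->]]] [k' [a' [Kk' ->]]] E.
  have a0 : a = 0.
    have := congr1 (fun f : M => f (1%g, (t, false))) E.
    rewrite /= ev // /shift /act /= ev // mulg1 eqxx invg_eq1 (negPf w1) mulr1.
    by rewrite mulr0 => /eqP; rewrite oppr_eq0 => /eqP.
  have a'0 : a' = 0.
    have := congr1 (fun f : M => f (w, (t, false))) E.
    rewrite /= ev // /shift /act /= ev // mulVg eqxx (negPf w1) mulr1.
    by rewrite mulr0 => /esym /eqP; rewrite oppr_eq0 => /eqP.
  move: E; rewrite a0 a'0 !scale0r !addr0; apply: K1 => //; exact/eqP.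
- move=> x y [k [a [Kk E]]].
  have aE : - a = (base t == x)%:R - (base t == y)%:R.
    by have := congr1 (fun f : M => f (base t)) E; rewrite ev // eqxx mulr1.
  have [//|/eqP xy] := pselect (x = y).
  case: (base t =P x) => [xt|_] in aE.
    have {}aE : a = -1.
      rewrite -xt in xy; case: eqP aE => [yt|_ /eqP]; first by rewrite yt eqxx in xy.
      by rewrite subr0 eqr_oppLR => /eqP.
    case: (mK y); suff -> : m - delta y = k by [].
    move: E; rewrite aE scaleN1r -xt => E; apply/funext => z.
    have := congr1 (fun f : M => f z) E; rewrite !fctE; lra.
  case: (base t =P y) => [yt|_] in aE.
    have {}aE : a = 1.
      by apply/eqP; rewrite -eqr_opp aE sub0r.
    case: (mK x); suff -> : m - delta x = - k by exact: subspaceN.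
    move: E; rewrite aE scale1r -yt => E; apply/funext => z.
    have := congr1 (fun f : M => f z) E; rewrite !fctE; lra.
  move/eqP: aE; rewrite subr0 oppr_eq0 => /eqP a0.
  by move: E; rewrite a0 scale0r addr0 => E; apply: K2; rewrite E.
- move=> _ [k [a [Kk ->]]] k0; have := k0 1%g t.
  rewrite ev // eqxx mulr1 => /eqP; rewrite oppr_eq0 => /eqP a0.
  move: k0; rewrite a0 scale0r addr0; exact: K3.
Qed.

(** If single points were used instead, two tasks would put the difference of two points into [K].
    The sum takes equal values on the two orbits, which no difference of points does with a nonzero
    value. *)
Definition delta2 t : M := delta (1%g, (t, false)) + delta (1%g, (t, true)).

(* Comparing the coefficients at 1, w, v and vw in the two fresh orbits, a relation
   k = v k' survives only for v = w or v = w^-1, and then it expresses a multiple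
   of m as an element of K + wK. *)
Lemma good_extend2 K t w m : subspace K -> good K ->
  (forall k, K k -> fresh t k) -> fresh t m -> w <> 1%g ->
  ~ (exists k k', [/\ K k, K k' & m = k + shift w k']) ->
  good (extend2 K (delta2 t) (m - shift w (delta2 t))).
Proof.
move=> subK [K1 K2 K3] fK fm /eqP w1 mK.
have ev k a b g c : K k ->
    (k + a *: delta2 t + b *: (m - shift w (delta2 t))) (g, (t, c)) =
    a * (g == 1%g)%:R - b * (g == w)%:R.
  have du h : delta2 t (h, (t, c)) = (h == 1%g)%:R.
    transitivity (((h, (t, c)) == (1%g, (t, false)))%:R +
      ((h, (t, c)) == (1%g, (t, true)))%:R : rat); first by [].
    rewrite !xpair_eqE eqxx /=; case: c; rewrite /= ?andbF ?andbT ?add0r ?addr0 //.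
  move=> Kk; transitivity (k (g, (t, c)) + a * delta2 t (g, (t, c)) +
    b * (m (g, (t, c)) - delta2 t ((w^-1 * g)%g, (t, c)))); first by [].
  rewrite fK // fm !du add0r sub0r mulrN; congr (_ - _ * (nat_of_bool _)%:R).
  by rewrite -(inj_eq (mulgI w)) mulVKg mulg1.
split.
- move=> v _ _ /eqP v1 [k [a [b [Kk ->]]]] [k' [a' [b' [Kk' ->]]]] E.
  (* The relation restricted to the fresh orbit: the left side is supported on 1 and [w], the right
     side on [v] and [v * w]. *)
  have e g : a * (g == 1%g)%:R - b * (g == w)%:R =
      a' * (g == v)%:R - b' * (g == (v * w)%g)%:R.
    have := congr1 (fun f : M => f (g, (t, false))) E.
    rewrite /= ev // /shift /act /= ev // => ->.
    have sw h : (v^-1 * g == h)%g = (g == v * h)%g.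
      by rewrite -(inj_eq (mulgI v)) mulVKg.
    by rewrite !sw mulg1.
  have wvw : (w == v * w)%g = false.
    by apply: contraNF v1 => /eqP; rewrite -{1}[w]mul1g => /mulIg <-.
  have vvw : (v == v * w)%g = false.
    by apply: contraNF w1 => /eqP; rewrite -{1}[v]mulg1 => /mulgI <-.
  have e1 : a = - (b' * (v * w == 1)%g%:R).
    have := e 1%g; rewrite eqxx !(eq_sym 1%g) (negPf w1) (negPf v1).
    by rewrite mulr1 !mulr0 subr0 sub0r.
  have ew : - b = a' * (v == w)%:R.
    have := e w; rewrite eqxx (negPf w1) wvw (eq_sym w v).
    by rewrite mulr1 !mulr0 subr0 sub0r.
  have ev' : - (b * (v == w)%:R) = a'.
    have := e v; rewrite eqxx (negPf v1) vvw.
    by rewrite mulr1 !mulr0 subr0 sub0r.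
  have evw : a * (v * w == 1)%g%:R = - b'.
    have := e (v * w)%g; rewrite eqxx ![(v * w == _)%g]eq_sym wvw vvw eq_sym.
    by rewrite mulr1 !mulr0 subr0 sub0r.
  have [a0 b0] : a = 0 /\ b = 0.
    have [vw|vw] := eqVneq v w.
      subst v.
      rewrite eqxx !mulr1 in ew ev'.
      (* Without elements of order two, [v * w] differs from 1 here, so [a] and [b'] vanish and only
         the multiples of [shift w (delta2 t)] cancel. What remains is [b m = w k' - k]. *)
      have ww : (w * w == 1)%g = false.
        by apply/negP => /eqP /no2 /eqP; rewrite (negPf w1).
      rewrite ww !mulr0 oppr0 in e1 evw.
      split=> //; apply/eqP/negPn/negP => b0; apply: mK.
      move/esym/eqP: evw; rewrite oppr_eq0 => /eqP b'0.
      exists (- b^-1 *: k), (b^-1 *: k'); split; try exact: subspaceZ.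
      apply: (scalerI b0); rewrite scalerDr -!shiftZ !scalerA mulrN !mulfV //.
      move: E; rewrite e1 b'0 !scale0r -ev' !addr0 /delta2 !(shiftD, shiftZ) => E.
      apply/funext => z; have := congr1 (fun f : M => f z) E.
      rewrite !fctE /GRing.scale /=; lra.
    rewrite (negPf vw) !mulr0 oppr0 in ew ev'.
    move/eqP: ew; rewrite oppr_eq0 => /eqP b0.
    have [vwe|vwn] := eqVneq (v * w)%g 1%g; last first.
      by split=> //; rewrite e1 (negPf vwn) mulr0 oppr0.
    (* Now [v] is the inverse of [w]; applying [w] to the relation leaves [a m = k' - w k]. *)
    split=> //; apply/eqP/negPn/negP => a0; apply: mK.
    rewrite vwe eqxx mulr1 in e1; have b'E : b' = - a by rewrite e1 opprK.
    have wv : (w * v = 1)%g.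
      by apply: (mulgI v); rewrite mulgA vwe mul1g mulg1.
    exists (a^-1 *: k'), (- a^-1 *: k); split; try exact: subspaceZ.
    apply: (scalerI a0); rewrite scalerDr -!shiftZ !scalerA mulrN !mulfV //.
    move: E; rewrite b0 -ev' b'E !scale0r !addr0.
    move=> /(congr1 (shift w)).
    rewrite -shiftM wv shift1 /delta2 !(shiftD, shiftZ) => E.
    apply/funext => z; have := congr1 (fun f : M => f z) E.
    rewrite !fctE /GRing.scale /=; lra.
  have a'0 : a' = 0 by rewrite -ev' b0 mul0r oppr0.
  have b'0 : b' = 0 by apply/eqP; rewrite -oppr_eq0 -evw a0 mul0r.
  move: E; rewrite a0 b0 a'0 b'0 !scale0r !addr0; apply: K1 => //; exact/eqP.
- move=> x y [k [a [b [Kk E]]]].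
  (* A difference of two points attains a nonzero value at one point at most, so a value common to
     both orbits is 0. *)
  have key g (c : rat) : (forall d, (delta x - delta y) (g, (t, d)) = c) -> c = 0.
    move=> xyE.
    have de d : (((g, (t, d)) == x)%:R - ((g, (t, d)) == y)%:R : rat) = c.
      exact: (xyE d).
    have ne : forall x, (g, (t, true)) = x -> ((g, (t, false)) == x) = false.
      by move=> _ <-; apply/eqP => -[].
    move: (de true) (de false).
    case: eqP => [/ne ->|_]; case: eqP => [/ne ->|_];
      by do ?[case: eqP => _]; rewrite /=; lra.
  have e g d := congr1 (fun f : M => f (g, (t, d))) E.
  have a0 : a = 0.
    apply: (key 1%g) => d; rewrite e ev // eqxx (eq_sym 1%g) (negPf w1).
    by rewrite mulr1 mulr0 subr0.
  have b0 : b = 0.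
    apply/eqP; rewrite -oppr_eq0; apply/eqP; apply: (key w) => d.
    by rewrite e ev // eqxx (negPf w1) mulr1 mulr0 sub0r.
  by move: E; rewrite a0 b0 !scale0r !addr0 => E; apply: K2; rewrite E.
- move=> _ [k [a [b [Kk ->]]]] k0.
  have a0 : a = 0.
    have := k0 1%g t; rewrite ev // eqxx (eq_sym 1%g) (negPf w1).
    by rewrite mulr1 mulr0 subr0.
  have b0 : b = 0.
    have := k0 w t; rewrite ev // eqxx (negPf w1) mulr1 mulr0 sub0r => /eqP.
    by rewrite oppr_eq0 => /eqP.
  move: k0; rewrite a0 b0 !scale0r !addr0; exact: K3.
Qed.

Lemma good_sub K K' : K `<=` K' -> good K' -> good K.
Proof.
move=> KK' [K1 K2 K3]; split.
- by move=> w k k' w1 /KK' Kk /KK' Kk'; exact: K1.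
- by move=> x y /KK'; exact: K2.
- by move=> k /KK'; exact: K3.
Qed.

(** * The transfinite recursion *)

Section Recursion.
Variables (lt : I -> I -> Prop) (wo : I -> F) (mo : I -> M).
Hypotheses (lt_wf : well_founded lt).
Hypothesis (lt_trans : forall s t u, lt s t -> lt t u -> lt s u).
Hypothesis (lt_total : forall s t, [\/ lt s t, s = t | lt t s]).
Hypothesis (mo_supp : forall s t, ~ lt s t -> fresh s (mo t)).

Definition rels t : set M :=
  if wo t == 1%g then [set mo t - delta (base t)]
  else [set delta2 t; mo t - shift (wo t) (delta2 t)].

(* Here wo t = 1 marks the task of putting an element of X in the coset of mo t. *)
Definition kernel_step t (D : forall s, lt s t -> Prop) : Prop :=
  let K := linspan [set r | exists s (st : lt s t), D s st /\ rels s r] in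
  if wo t == 1%g then forall y, ~ K (mo t - delta y)
  else ~ exists k k', [/\ K k, K k' & mo t = k + shift (wo t) k'].

(** A stage acts only if its requirement fails for the span of the relations added earlier. The
    recursion thus decides which stages act, and every intermediate subspace is the span belonging
    to a set of stages. *)
Definition performed : I -> Prop := Fix lt_wf (fun=> Prop) kernel_step.

Definition kernel (A : set I) : set M :=
  linspan [set r | exists s, [/\ A s, performed s & rels s r]].

Lemma performedE t : performed t =
  if wo t == 1%g then forall y, ~ kernel (lt^~ t) (mo t - delta y)
  else ~ exists k k',
    [/\ kernel (lt^~ t) k, kernel (lt^~ t) k' & mo t = k + shift (wo t) k'].
Proof.
rewrite {1}/performed Fix_eq => [|s f g fg]; last first.
  by congr kernel_step; apply: functional_extensionality_dep => u; apply/funext.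
rewrite -/performed /kernel_step.
suff -> : [set r | exists s (_ : lt s t), performed s /\ rels s r] =
  [set r | exists s, [/\ lt s t, performed s & rels s r]] by [].
by apply/seteqP; split=> r [s]; [case=> st [Ds rs]|case=> st Ds rs]; exists s.
Qed.

Lemma kernel_sub (A B : set I) : A `<=` B -> kernel A `<=` kernel B.
Proof. by move=> AB; apply: linspan_subset => r [s [/AB]]; exists s. Qed.

Definition upto t : set I := fun s => lt s t \/ s = t.

Lemma upto_sub s t : lt s t -> upto s `<=` upto t.
Proof. by move=> st u [us|->]; left => //; exact: lt_trans st. Qed.

(** A combination uses finitely many stages, hence has a last one; the case [k = 0] covers the empty
    combination. *)
Lemma kernel_upto (A : set I) k : kernel A k ->
  k = 0 \/ exists2 s, A s & kernel (upto s) k.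
Proof.
move=> [l [lP ->]]; elim: l lP => [|p l IH] lP.
  by left; rewrite lin_nil.
right; have [s [As Ds rs]] := lP p (mem_head _ _).
have ps : kernel (upto s) p.2 by apply: sub_linspan; exists s; split=> //; right.
have subK u : subspace (kernel (upto u)) by exact: subspace_linspan.
rewrite lin_cons.
have [|->|[u Au lu]] := IH; first by move=> q lq; apply: lP; rewrite inE lq orbT.
  by exists s => //; rewrite addr0; exact: subspaceZ.
have [su|su|us] := lt_total s u.
- by exists u => //; apply: (subK _).2 => //; exact: kernel_sub (upto_sub su) _ ps.
- by exists s => //; apply: (subK _).2 => //; rewrite su.
- by exists s => //; apply: (subK _).2 => //; exact: kernel_sub (upto_sub us) _ lu.
Qed.

Lemma kernel_upto2 (A : set I) k k' :
  (forall s, A s -> good (kernel (upto s))) -> kernel A k -> kernel A k' ->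
  exists K, [/\ good K, K k & K k'].
Proof.
move=> Agood /kernel_upto[->|[s As sk]] /kernel_upto[->|[s' As' sk']].
- by exists [set 0]; split=> //; exact: good0.
- by exists (kernel (upto s')); split; [exact: Agood|exact: (subspace_linspan _).1|].
- by exists (kernel (upto s)); split; [exact: Agood| |exact: (subspace_linspan _).1].
have [ss'|ss'|ss'] := lt_total s s'.
- exists (kernel (upto s')); split=> //; first exact: Agood.
  exact: kernel_sub (upto_sub ss') _ sk.
- by exists (kernel (upto s)); split=> //; [exact: Agood|rewrite ss'].
- exists (kernel (upto s)); split=> //; first exact: Agood.
  exact: kernel_sub (upto_sub ss') _ sk'.
Qed.

(** Each condition of [good] speaks of at most two elements of the subspace, and any two lie in a
    common good one. *)
Lemma good_kernel_chain (A : set I) :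
  (forall s, A s -> good (kernel (upto s))) -> good (kernel A).
Proof.
move=> Agood; split.
- move=> w k k' w1 Kk Kk'.
  by have [K [[K1 _ _] {}Kk {}Kk']] := kernel_upto2 Agood Kk Kk'; exact: K1.
- move=> x y Kxy; have [K [[_ K2 _] {}Kxy _]] := kernel_upto2 Agood Kxy Kxy.
  exact: K2.
- move=> k Kk; have [K [[_ _ K3] {}Kk _]] := kernel_upto2 Agood Kk Kk.
  exact: K3.
Qed.

Lemma fresh_delta s t g b : s <> t -> fresh t (delta (g, (s, b))).
Proof.
move=> st h c; rewrite /delta; case: eqP => // -[_ ts _].
by case: st.
Qed.

Lemma subspace_fresh t : subspace (fresh t).
Proof.
split=> // a k k' kt k't g b; transitivity (a * k (g, (t, b)) + k' (g, (t, b))).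
  by [].
by rewrite kt k't mulr0 addr0.
Qed.

(** The relations of a stage [s] before [t] live on the orbits of [s] and on the support of [mo s],
    whose orbits have indices before [s]; none of these is [t]. *)
Lemma fresh_kernel t k : kernel (lt^~ t) k -> fresh t k.
Proof.
apply: linspan_sub => [|r [s [st _]]]; first exact: subspace_fresh.
have sNt : s <> t by move=> E; rewrite E in st; exact: wf_irr st.
have tNs := wf_asym lt_wf st.
have fB := subspaceB (subspace_fresh t); have fD := subspaceD (subspace_fresh t).
have fdouble : fresh t (delta2 s) by apply: fD; exact: fresh_delta.
rewrite /rels; case: ifP => _; first by move->; apply: fB;
  [exact: mo_supp|exact: fresh_delta].
case=> [->//|->]; apply: fB; first exact: mo_supp.
by move=> g b; exact: fdouble.
Qed.

Lemma kernel_uptoE t : kernel (upto t) `<=`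
  [set k | exists k0 r, [/\ kernel (lt^~ t) k0,
    linspan [set r | performed t /\ rels t r] r & k = k0 + r]].
Proof.
have sub1 (G : set M) := subspace_linspan G; apply: linspan_sub.
  split=> [|a _ _ [x0 [x1 [Kx0 Sx1 ->]]] [y0 [y1 [Ky0 Sy1 ->]]]].
    by exists 0, 0; rewrite addr0; split=> //; exact: (sub1 _).1.
  exists (a *: x0 + y0), (a *: x1 + y1).
  split; [exact: (sub1 _).2|exact: (sub1 _).2|].
  by rewrite scalerDr addrACA.
move=> r [s [[st|->] Ds rs]].
  exists r, 0; rewrite addr0; split=> //; last exact: (sub1 _).1.
  by apply: sub_linspan; exists s.
by exists 0, r; rewrite add0r; split=> //; [exact: (sub1 _).1|exact: sub_linspan].
Qed.

(** A stage that does not act leaves the subspace unchanged; one that acts yields an extension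
    covered by [good_extend1] or [good_extend2]. *)
Lemma good_kernel_step t : good (kernel (lt^~ t)) -> good (kernel (upto t)).
Proof.
move=> gK; have subK : subspace (kernel (lt^~ t)) by exact: subspace_linspan.
have [Dt|nDt] := pselect (performed t); last first.
  apply: good_sub gK => k /kernel_uptoE[k0 [r [Kk0 rS ->]]].
  suff -> : r = 0 by rewrite addr0.
  suff : linspan [set r | performed t /\ rels t r] `<=` [set 0] by apply.
  apply: linspan_sub => [|x [/nDt]] //.
  by split=> // a x y -> ->; rewrite scaler0 addr0.
have fK := @fresh_kernel t; have fm := mo_supp (@wf_irr _ _ lt_wf t).
move: Dt; rewrite performedE; case: ifP => [w1|/negbT/eqP w1] H.
- apply: good_sub (good_extend1 subK gK fK fm H).
  move=> k /kernel_uptoE[k0 [r [Kk0 rS ->]]].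
  suff [a ->] : [set r | exists a : rat, r = a *: (mo t - delta (base t))] r.
    by exists k0, a.
  move: r rS; apply: linspan_sub => [|x [_]].
    split=> [|a _ _ [b ->] [c ->]]; first by exists 0; rewrite scale0r.
    by exists (a * b + c); rewrite scalerDl scalerA.
  by rewrite /rels w1 => ->; exists 1; rewrite scale1r.
- apply: good_sub (good_extend2 subK gK fK fm w1 H).
  move=> k /kernel_uptoE[k0 [r [Kk0 rS ->]]].
  suff [a [b ->]] : [set r | exists a b : rat,
      r = a *: delta2 t + b *: (mo t - shift (wo t) (delta2 t))] r.
    by exists k0, a, b; rewrite addrA.
  move: r rS; apply: linspan_sub => [|x [_]].
    split=> [|a _ _ [b [c ->]] [b' [c' ->]]].
      by exists 0, 0; rewrite !scale0r addr0.
    exists (a * b + b'), (a * c + c').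
    by rewrite scalerDr !scalerDl !scalerA addrACA.
  rewrite /rels; case: eqP => // _ -[->|->].
    by exists 1, 0; rewrite scale1r scale0r addr0.
  by exists 0, 1; rewrite scale1r scale0r add0r.
Qed.

(** The stages before [t] are covered by the closed segments [upto s] with [s] before [t], so
    successor and limit stages need no separate treatment. *)
Lemma good_kernel : good (kernel setT).
Proof.
apply: good_kernel_chain => s _; elim: (lt_wf s) => t _ IH.
by apply: good_kernel_step; apply: good_kernel_chain.
Qed.

(** If the stage acted, [m = (m - w u) + w u] with both [m - w u] and [u] in the kernel; if not,
    earlier relations already give a decomposition. *)
Lemma kernel_act t : wo t <> 1%g ->
  exists k k', [/\ kernel setT k, kernel setT k' & mo t = k + shift (wo t) k'].
Proof.
move=> w1; have [Dt|] := pselect (performed t); last first.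
  rewrite performedE; case: eqP => // _ /contrapT [k [k' [Kk Kk' E]]].
  by exists k, k'; split=> //; [move: Kk|move: Kk']; exact: kernel_sub.
exists (mo t - shift (wo t) (delta2 t)), (delta2 t); rewrite subrK.
split=> //; apply: sub_linspan; exists t; split=> //;
  rewrite /rels; case: eqP => // _;
  by [right|left].
Qed.

Lemma kernel_delta t : wo t = 1%g -> exists y, kernel setT (mo t - delta y).
Proof.
move=> w1; have [Dt|] := pselect (performed t); last first.
  rewrite performedE w1 eqxx => /existsNP[y /contrapT Ky].
  by exists y; move: Ky; exact: kernel_sub.
by exists (base t); apply: sub_linspan; exists t; split=> //; rewrite /rels w1 eqxx.
Qed.

End Recursion.
End Kernel.

(** * From K to an action on the reals *)

(** An alias of the reals that carries their structure of a rational vector space. *)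
Definition ratmod (R : realType) : Type := R.

Section RatModule.
Variable R : realType.

HB.instance Definition _ := GRing.Zmodule.on (ratmod R).

Definition ratscale (q : rat) (x : ratmod R) : ratmod R := ratr q * (x : R).

Lemma ratscaleA a b (x : ratmod R) : ratscale a (ratscale b x) = ratscale (a * b) x.
Proof. by rewrite /ratscale rmorphM /= mulrA. Qed.

Lemma ratscale1 : left_id 1 ratscale.
Proof. by move=> x; rewrite /ratscale rmorph1 mul1r. Qed.

Lemma ratscaleDr : right_distributive ratscale +%R.
Proof. by move=> a x y; exact: mulrDr. Qed.

Lemma ratscaleDl (x : ratmod R) : {morph ratscale^~ x : a b / a + b}.
Proof. by move=> a b; rewrite /ratscale rmorphD /=; exact: mulrDl. Qed.

HB.instance Definition _ := GRing.Zmodule_isLmodule.Build rat (ratmod R)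
  ratscaleA ratscale1 ratscaleDr ratscaleDl.

End RatModule.

Section Model.
Variables (R : realType) (F : groupType) (J : choiceType).
Local Notation X := (F * J)%type.
Local Notation M := (X -> rat^o).
Variables (K : set M) (subK : subspace K).
Hypothesis K_act0 :
  forall w k k', w <> 1%g -> K k -> K k' -> k = shift w k' -> k = 0.
Hypothesis K_delta_inj : forall x y, K (delta x - delta y) -> x = y.
Hypothesis K_fin : forall k, K k -> exists l, k = lin (@delta F J) l.
Hypothesis K_act : forall w l, w <> 1%g ->
  exists k k', [/\ K k, K k' & lin (@delta F J) l = k + shift w k'].
Hypothesis K_delta : forall l, exists y, K (lin (@delta F J) l - delta y).
(** [B] indexes a basis of Q[X] modulo [K], [H] is a Hamel basis of the reals, and [theta] matches
    the two. *)
Variables (B : set X) (H : set (ratmod R)) (theta : X -> ratmod R).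
Hypothesis freeB : free_mod (@delta F J) K B.
Hypothesis genB :
  forall x, exists l, {in l, forall p, B p.2} /\ K (delta x - lin (@delta F J) l).
Hypothesis freeH : free_mod (fun r : ratmod R => r) [set 0] H.
Hypothesis genH : forall r, exists l,
  {in l, forall p, H p.2} /\ r = lin (fun r : ratmod R => r) l.
Hypothesis thetaB : set_bij B H theta.
Local Notation delta := (@delta F J).

(* The isomorphism from M/K to R matching the bases B and H, as a relation. *)
Definition represents (m : M) (r : ratmod R) := exists l,
  [/\ {in l, forall p, B p.2}, K (m - lin delta l) & r = lin theta l].

Lemma represents_lin a m r m' r' : represents m r -> represents m' r' ->
  represents (a *: m + m') (a *: r + r').
Proof.
move=> [l [lB Kl ->]] [l' [l'B Kl' ->]]; exists (scale_comb a l ++ l'); split.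
- by move=> p; rewrite mem_cat => /orP[/mapP[q lq ->]|/l'B//]; exact: (lB q).
- rewrite lin_cat lin_scale opprD addrACA -scalerBr.
  exact: subK.2.
- by rewrite lin_cat lin_scale.
Qed.

Lemma lin_map_theta (l : seq (rat * X)) :
  lin theta l = lin (fun r => r) [seq (p.1, theta p.2) | p <- l].
Proof. by rewrite /lin big_map. Qed.

Lemma coef_theta l : {in l, forall p, B p.2} -> lin theta l = 0 ->
  forall x, coef l x = 0.
Proof.
move=> lB l0 x; have [Bx|nBx] := pselect (B x); last first.
  rewrite /coef big_seq_cond big1 // => p /andP[/lB Bp /eqP px].
  by rewrite px in Bp.
have [thB thI _] := thetaB.
rewrite -(freeH (l := [seq (p.1, theta p.2) | p <- l]) _ _ (theta x)).
- rewrite /coef big_map /= [LHS]big_seq_cond [RHS]big_seq_cond.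
  apply: eq_bigl => p; case: (boolP (p \in l)) => //= lp.
  apply/eqP/eqP => [->//|]; apply: thI; rewrite inE //; exact: lB.
- by move=> _ /mapP[q lq ->]; apply: thB; exact: (lB q).
- by rewrite -lin_map_theta l0.
Qed.

(** Independence of [B] modulo [K] gives one direction, independence of [H] together with
    injectivity of [theta] on [B] the other. *)
Lemma represents0 m r : represents m r -> (K m <-> r = 0).
Proof.
move=> [l [lB Kl ->]]; split=> [Km|l0].
  apply: lin_coef0; apply: freeB => //.
  by rewrite -[lin _ l](subKr m); exact: subspaceB.
rewrite -(subrK (lin delta l) m); apply: subspaceD => //.
rewrite lin_coef0; [exact: subK.1|exact: coef_theta].
Qed.

Lemma represents_surj r : exists l, represents (lin delta l) r.
Proof.
have [l [lH ->]] := genH r; have [_ _ thS] := thetaB.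
elim: l lH => [|p l IH] lH.
  by exists [::], [::]; rewrite !lin_nil subrr; split=> //; exact: subK.1.
have [|l' rl'] := IH; first by move=> q lq; apply: lH; rewrite inE lq orbT.
have [x Bx xp] : exists2 x, B x & theta x = p.2.
  by have [x Bx xp] := thS _ (lH p (mem_head _ _)); exists x.
exists ((p.1, x) :: l'); rewrite !lin_cons; apply: represents_lin => //.
exists [:: (1, x)]; split; first by move=> q; rewrite inE => /eqP ->.
  by rewrite lin_cons lin_nil scale1r addr0 subrr; exact: subK.1.
by rewrite lin_cons lin_nil scale1r addr0.
Qed.

(** [phi x] is the real that represents [delta x]. It is injective because distinct points lie in
    distinct cosets, and onto because every coset contains a point. *)
Lemma coordinates : exists (phi : X -> ratmod R) (psi : ratmod R -> X),
  [/\ cancel phi psi, cancel psi phi &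
      forall l, K (lin delta l) <-> lin phi l = 0].
Proof.
have /choice[phi phiP] : forall x, exists r, represents (delta x) r.
  by move=> x; have [l [lB Kl]] := genB x; exists (lin theta l), l.
have rphi l : represents (lin delta l) (lin phi l).
  elim: l => [|p l IH].
    by exists [::]; rewrite !lin_nil subrr; split=> //; exact: subK.1.
  by rewrite !lin_cons; exact: represents_lin.
have phi0 l := represents0 (rphi l).
have phi_inj x y : phi x = phi y -> x = y.
  move=> xy; apply: K_delta_inj.
  have := phi0 [:: (1, x); (-1, y)].
  rewrite !lin_cons !lin_nil /= !scale1r !scaleN1r !addr0 xy subrr.
  by move=> ->.
have phi_surj r : exists x, phi x = r.
  have [l rl] := represents_surj r; have [y Ky] := K_delta l.
  exists y; apply/esym/eqP; rewrite -subr_eq0; apply/eqP.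
  have := represents_lin (-1) (phiP y) rl; rewrite !scaleN1r [_ + r]addrC.
  by move=> /represents0 [<- //]; rewrite addrC.
have [psi psiK] := choice phi_surj.
by exists phi, psi; split=> // x; apply: phi_inj; rewrite psiK.
Qed.

(** * Graphs of the transported action *)

Section Graph.
Variables (phi : X -> ratmod R) (psi : ratmod R -> X).
Hypotheses (phiK : cancel phi psi) (psiK : cancel psi phi).
Hypothesis phi0 : forall l, K (lin delta l) <-> lin phi l = 0.

Definition induced (w : F) (r : R) : R := phi (act w (psi r)).

Lemma induced1 : induced 1%g =1 id.
Proof. by move=> r; rewrite /induced act1 psiK. Qed.

Lemma inducedM w w' : induced (w * w')%g =1 induced w \o induced w'.
Proof. by move=> r; rewrite /induced /= phiK actM. Qed.

Local Notation plane := (R^o * R^o)%type.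

Lemma ratcomb_coords (s : {fset plane}) (c : plane -> rat) :
  (ratcomb s c).1 = \sum_(p <- s) ratr (c p) * p.1 /\
  (ratcomb s c).2 = \sum_(p <- s) ratr (c p) * p.2.
Proof. by rewrite /ratcomb !raddf_sum. Qed.

(** The two coordinates of a vanishing combination say that [l] and [w l] both lie in [K], so [l] is
    zero in Q[X]. Points of a graph are determined by their first coordinates, so no coefficients
    were merged. *)
Lemma induced_free w : w <> 1%g -> ratfree (graph_of (induced w)).
Proof.
move=> w1 s c sG s0.
pose l := [seq (c p, psi p.1) | p <- (s : seq plane)].
have sP (p : plane) : p \in (s : seq plane) -> graph_of (induced w) p by exact: sG.
have [e1 e2] := ratcomb_coords s c; rewrite s0 /= in e1 e2.
have k1 : K (lin delta l).
  by apply/phi0; rewrite /lin big_map [RHS]e1; apply: eq_bigr => p _; rewrite psiK.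
have k2 : K (shift w (lin delta l)).
  rewrite shift_lin; apply/phi0; rewrite /lin !big_map [RHS]e2 big_seq [RHS]big_seq.
  by apply: eq_bigr => p /sP ->.
have l0 : lin delta l = 0.
  apply: (K_act0 (w := w^-1%g) _ k1 k2); last by rewrite shiftK.
  by move/eqP; rewrite invg_eq1 => /eqP.
move=> p sp; have : coef l (psi p.1) = 0 by rewrite -lin_delta l0.
rewrite /coef big_map /= big_mkcond (bigD1_seq p) //= eqxx => <-.
rewrite big_seq_cond big1 ?addr0 // => q /andP[sq qp].
case: eqP => // /(can_inj psiK) qp1; case/eqP: qp.
rewrite [q]surjective_pairing [p]surjective_pairing.
by rewrite (sP q sq) (sP p sp) qp1.
Qed.

Lemma induced_gen w : w <> 1%g -> ratspan (graph_of (induced w)) = setT.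
Proof.
move=> w1; apply/seteqP; split=> // -[r1 r2] _.
have wV1 : w^-1%g <> 1%g by move/eqP; rewrite invg_eq1 => /eqP.
(* The combination sought is congruent modulo [K] to [psi r1], and its image under [w] to [psi r2].
   Decomposing the difference of [psi r1] and the translate of [psi r2] by the inverse of [w]
   provides it as [psi r1 - k]; [K_fin] turns it into a list. *)
have [k [k' [Kk Kk' E]]] :=
  K_act [:: (1, psi r1); (-1, act w^-1%g (psi r2))] wV1.
have [lk lkE] := K_fin Kk.
pose l := (1, psi r1) :: scale_comb (-1) lk.
have lE : lin delta l = delta (psi r1) - k.
  by rewrite lin_cons lin_scale scale1r scaleN1r -lkE.
have l1 : lin phi l = r1.
  have /phi0 : K (lin delta ((-1, psi r1) :: l)).
    by rewrite lin_cons lE scaleN1r addKr; exact: subspaceN.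
  by rewrite lin_cons scaleN1r /= psiK => /eqP; rewrite addrC subr_eq0 => /eqP.
have l2 : lin phi [seq (p.1, act w p.2) | p <- l] = r2.
  have /phi0 : K (lin delta ((-1, psi r2) :: [seq (p.1, act w p.2) | p <- l])).
    rewrite lin_cons -shift_lin lE scaleN1r.
    suff -> : delta (psi r1) - k = shift w^-1%g (k' + delta (psi r2)).
      by rewrite -shiftM mulgV shift1 addrC addrK.
    rewrite shiftD shift_delta; apply/eqP; rewrite subr_eq addrAC -subr_eq addrC.
    move: E; rewrite !lin_cons lin_nil scale1r scaleN1r addr0 /= => <-.
    by rewrite addrC.
  by rewrite lin_cons scaleN1r /= psiK => /eqP; rewrite addrC subr_eq0 => /eqP.
pose g (x : X) : plane := (phi x, phi (act w x)).
have g_inj : injective g by move=> x y [/(can_inj phiK)].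
pose s := undup (map snd l).
exists (seq_fset tt (map g s)), (fun p => coef l (psi p.1)); split.
  move=> p sp; have /mapP[x _ ->] : p \in map g s by rewrite -(seq_fsetE tt).
  by rewrite /graph_of /induced /= phiK.
have sl : {in l, forall p, p.2 \in s} by move=> p lp; rewrite mem_undup map_f.
have us : uniq s by exact: undup_uniq.
have perm : perm_eq (seq_fset tt (map g s)) (map g s).
  by rewrite -[X in perm_eq _ X]undup_id ?map_inj_uniq // seq_fset_perm.
have [e1 e2] := ratcomb_coords (seq_fset tt (map g s)) (fun p => coef l (psi p.1)).
have sumE (v : X -> ratmod R) : lin v l = \sum_(x <- s) coef l x *: v x.
  exact: lin_coef.
rewrite [RHS]surjective_pairing e1 e2; congr pair.
- rewrite (perm_big _ perm) big_map -[LHS]l1 sumE.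
  by apply: eq_bigr => x _; rewrite /= phiK.
- rewrite (perm_big _ perm) big_map -[LHS]l2 /lin big_map.
  rewrite -/(lin (fun x => phi (act w x)) l) sumE.
  by apply: eq_bigr => x _; rewrite /= phiK.
Qed.
End Graph.
End Model.

(** * A linearly independent family of continuum many reals *)

Section Cardinality.

Definition embeds (A B : Type) := exists f : A -> B, injective f.

(** The reference set of cardinality continuum: other sets are compared with it by injections, and
    [card_eq_inj] combines two of these by the Schroeder-Bernstein theorem. *)
Definition bits := nat -> bool.

Lemma embeds_trans A B C : embeds A B -> embeds B C -> embeds A C.
Proof. by move=> [f fI] [g gI]; exists (g \o f); exact: inj_comp. Qed.

Lemma embeds_count (A : countType) : embeds A bits.
Proof.
exists (fun (a : A) n => n == choice.pickle a) => a b.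
move=> /(congr1 (@^~ (choice.pickle a))) /=.
by rewrite eqxx => /esym /eqP /(pcan_inj choice.pickleK).
Qed.

Lemma embeds_pair A B : embeds A bits -> embeds B bits -> embeds (A * B) bits.
Proof.
move=> [f fI] [g gI].
exists (fun ab n => if odd n then f ab.1 n./2 else g ab.2 n./2) => -[a b] [a' b'] E.
congr pair; [apply: fI|apply: gI]; apply/funext => n.
  by have := congr1 (@^~ n.*2.+1) E; rewrite /= odd_double /= uphalf_double.
by have := congr1 (@^~ n.*2) E; rewrite /= odd_double /= doubleK.
Qed.

Lemma embeds_seq A : embeds A bits -> embeds (seq A) bits.
Proof.
move=> [f fI].
(* A two-dimensional array: row 0 records the length, row [i.+1] the code of the entry [i]. *)
pose code (s : seq A) (ij : nat * nat) : bool :=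
  if ij.1 is i.+1 then nth (fun=> false) (map f s) i ij.2 else (ij.2 < size s)%N.
exists (fun s n => if choice.unpickle n is Some ij then code s ij else false).
move=> s s' E.
have {}E i j : code s (i, j) = code s' (i, j).
  by have := congr1 (@^~ (choice.pickle (i, j))) E; rewrite choice.pickleK.
have szE : size s = size s'.
  have s1 : (size s' < size s)%N = false.
    by have := E 0%N (size s'); rewrite /code /= ltnn.
  have s2 : (size s < size s')%N = false.
    by have := E 0%N (size s); rewrite /code /= ltnn => /esym.
  by apply/eqP; rewrite eqn_leq [(size s <= _)%N]leqNgt s1 leqNgt s2.
apply: (inj_map fI); apply: (@eq_from_nth _ (fun=> false)).
  by rewrite !size_map.
by move=> i _; apply/funext => j; exact: (E i.+1 j).
Qed.

(** A real is coded by the set of rationals below it. *)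
Lemma embeds_real (R : realType) : embeds R bits.
Proof.
pose cut (r : R) n :=
  if @choice.unpickle rat n is Some q then ratr q < r else false.
have lt r s : r < s -> cut r <> cut s.
  move=> rs; have [q] := rat_in_itvoo rs; rewrite in_itv /= => /andP[rq qs].
  move/(congr1 (@^~ (choice.pickle q))); rewrite /cut choice.pickleK qs.
  by move=> /lt_trans /(_ rq); rewrite ltxx.
exists cut => r s E; apply/eqP/negPn/negP.
by rewrite neq_lt => /orP[/lt|/lt]; apply.
Qed.

Lemma card_le_inj A B (S : set A) (S' : set B) (f : A -> B) :
  injective f -> (forall a, S a -> S' (f a)) -> (S #<= S')%card.
Proof.
move=> fI fS; have [g] : $|{injfun S >-> S'}|; last exact: inj_card_le.
by apply/injfunPex; exists f => // a b _ _; exact: fI.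
Qed.

Lemma card_eq_inj A B (S : set A) (f : A -> B) (g : B -> A) :
  injective f -> injective g -> (forall b, S (g b)) -> (S #= [set: B])%card.
Proof.
move=> fI gI gS; rewrite card_eq_le.
by apply/andP; split; [exact: (card_le_inj fI)|exact: (card_le_inj gI)].
Qed.

End Cardinality.

(** * Independent series with factorial denominators *)

Section IndependentReals.
Variable R : realType.
Implicit Types (f g : bits) (n k : nat).

(* branch f is the characteristic function of the branch of f in the binary tree,
   under a coding of the nodes by natural numbers: distinct branches are almost
   disjoint. *)
Definition branch f k : bool :=
  if @choice.unpickle (seq bool) k is Some s then s == mkseq f (size s) else false.

(* numer f n / n! is the sum of branch f k / k! over k <= n. *)
Fixpoint numer f n : nat :=
  if n is m.+1 then (n * numer f m + branch f n)%N else branch f 0.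

(** [x] is the sum of [branch f k / k!]. The partial sums [a n] increase and the bounds [b n]
    decrease, so the supremum of the former lies between them. *)
Lemma branch_real f : exists x : R, forall n,
  (numer f n)%:R <= n`!%:R * x <= (numer f n)%:R + 2 / n.+1%:R.
Proof.
have fact_pos n : (0 : R) < n`!%:R by rewrite ltr0n fact_gt0.
pose a n : R := (numer f n)%:R / n`!%:R; pose b n : R := a n + 2 / (n.+1)`!%:R.
have aS n : a n.+1 = a n + (branch f n.+1)%:R / n.+1`!%:R.
  rewrite /a /= natrD mulrDl natrM factS natrM invfM mulrACA mulfV ?mul1r //.
  by rewrite pnatr_eq0.
have a_mono n k : a n <= a (n + k)%N.
  elim: k => [|k IH]; first by rewrite addn0.
  by apply: le_trans IH _; rewrite addnS aS lerDl divr_ge0 // ltW.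
(* The constant 2 works because [1/(m+1)! + 2/(m+2)!] is at most [2/(m+1)!]. *)
have b_mono n k : b (n + k)%N <= b n.
  elim: k => [|k IH]; first by rewrite addn0.
  apply: le_trans IH; rewrite addnS /b aS -addrA lerD2l.
  set m := (n + k)%N; rewrite [2]mulr2n [X in _ <= X]mulrDl mul1r.
  apply: lerD; first by apply: ler_piMl; [rewrite invr_ge0 ltW|case: (branch _ _)].
  rewrite [m.+2`!]factS natrM invfM mulrA ler_pdivrMr // mulVf ?gt_eqF //.
  by rewrite ler_pdivrMr ?ltr0n // mul1r -[1 + 1]/(2%:R) ler_nat.
have ab m n : a m <= b n.
  apply: le_trans (a_mono m n) _; apply: le_trans (b_mono n m).
  by rewrite addnC /b lerDl divr_ge0 // ltW.
exists (sup (range a)) => n.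
have bE : (numer f n)%:R + 2 / n.+1%:R = n`!%:R * b n.
  rewrite /b mulrDr /a mulrCA mulfV ?mulr1 ?gt_eqF // mulrCA; congr (_ + _ * _).
  by rewrite factS natrM invfM mulrCA mulfV ?mulr1 // gt_eqF.
rewrite bE; have -> : (numer f n)%:R = n`!%:R * a n :> R.
  by rewrite /a mulrCA mulfV ?mulr1 ?gt_eqF.
rewrite !ler_pM2l //; apply/andP; split.
  by apply: ub_le_sup; [exists (b 0%N) => _ [m _ <-]|exists n].
by apply: ge_sup; [exists (a 0%N), 0%N|move=> _ [m _ <-]].
Qed.

(** From some level on, the initial segment of [g] differs from those of the other sequences in
    [fs]. The codes of the initial segments of [g] are distinct, so one beyond that level is at
    least [k]. *)
Lemma branch_far (fs : seq bits) g k : exists2 n, (k <= n)%N &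
  {in fs, forall f, branch f n = (f == g)}.
Proof.
have [n0 n0P] : exists n0, forall n, (n0 <= n)%N ->
    {in fs, forall f, (mkseq f n == mkseq g n) = (f == g)}.
  elim: fs => [|f fs [n0 IH]]; first by exists 0%N.
  have [->|/eqP fg] := eqVneq f g.
    exists n0 => n n0n h; rewrite inE => /predU1P[->|]; first by rewrite !eqxx.
    exact: IH.
  have [m fgm] : exists m, f m <> g m.
    by apply/existsNP => fgE; apply: fg; apply/funext.
  exists (maxn n0 m.+1) => n; rewrite geq_max => /andP[n0n mn] h.
  rewrite inE => /predU1P[->|]; last exact: IH.
  rewrite (introF eqP fg); apply/eqP => /(congr1 (fun s => nth true s m)).
  by rewrite !nth_mkseq.
pose c n := @choice.pickle (seq bool) (mkseq g n).
have c_inj : injective c.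
  move=> m n /(pcan_inj choice.pickleK) /(congr1 size).
  by rewrite !size_mkseq.
have [n [n0n kn]] : exists n, (n0 <= n)%N /\ (k <= c n)%N.
  (* Otherwise [k + 1] distinct codes would all be below [k]. *)
  apply: contrapT => H.
  have : (k.+1 <= k)%N.
    rewrite -[X in (X <= _)%N](size_iota n0) -(size_map c).
    rewrite -[X in (_ <= X)%N](size_iota 0).
    apply: uniq_leq_size => [|_ /mapP[n + ->]].
      by rewrite map_inj_uniq ?iota_uniq.
    rewrite !mem_iota /= add0n => /andP[n0n _]; rewrite ltnNge; apply/negP => kc.
    by apply: H; exists n.
  by rewrite ltnn.
exists (c n) => // f ff; rewrite /branch choice.pickleK size_mkseq eq_sym.
exact: n0P.
Qed.

Lemma integral_comb (T : Type) (l : seq (rat * T)) :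
  exists (D : int) (l' : seq (int * T)),
  D != 0 /\ scale_comb D%:~R l = [seq (p.1%:~R, p.2) | p <- l'].
Proof.
elim: l => [|[q t] l [D [l' [D0 lE]]]]; first by exists 1, [::].
exists (D * denq q), ((D * numq q, t) :: [seq (denq q * p.1, p.2) | p <- l']).
split; first by rewrite mulf_neq0 // denq_neq0.
rewrite /= -map_comp; congr (_ :: _).
  by congr pair; rewrite /= !intrM numqE -mulrA [q * _]mulrC.
transitivity (scale_comb (denq q)%:~R (scale_comb D%:~R l)).
  rewrite /scale_comb -map_comp; apply: eq_map => p /=.
  by rewrite intrM mulrA [X in X * _]mulrC.
rewrite lE /scale_comb -map_comp; apply: eq_map => p /=.
by rewrite intrM.
Qed.

Definition branch_value f : ratmod R := projT1 (cid (branch_real f)).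

Lemma branch_valueP f n :
  (numer f n)%:R <= n`!%:R * (branch_value f : R) <= (numer f n)%:R + 2 / n.+1%:R.
Proof. by rewrite /branch_value; case: cid. Qed.

(* n! times the n-th partial sum of the vanishing series is an integer smaller than
   1 for large n, hence 0; so are all large coefficients of the series. *)
Lemma integral_branch_comb (l : seq (int * bits)) :
  \sum_(p <- l) p.1%:~R * (branch_value p.2 : R) = 0 ->
  forall g, \sum_(p <- l | p.2 == g) p.1 = 0.
Proof.
move=> l0 g; pose z n : int := \sum_(p <- l) p.1 * (numer p.2 n)%:Z.
pose C : nat := \sum_(p <- l) `|p.1|%N.
have z_small n : `|(z n)%:~R : R| <= C%:R * (2 / n.+1%:R).
  have -> : (z n)%:~R = \sum_(p <- l)
      p.1%:~R * ((numer p.2 n)%:R - n`!%:R * (branch_value p.2 : R)).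
    under [RHS]eq_bigr do rewrite mulrBr mulrCA.
    rewrite sumrB -mulr_sumr l0 mulr0 subr0 rmorph_sum /=.
    by apply: eq_bigr => p _; rewrite intrM.
  apply: le_trans (ler_norm_sum _ _ _) _; rewrite /C natr_sum mulr_suml.
  apply: ler_sum => p _; rewrite normrM -intr_norm natr_absz.
  apply: ler_wpM2l; first by rewrite ler0z.
  have /andP[h1 h2] := branch_valueP p.2 n.
  by rewrite distrC ger0_norm ?subr_ge0 // lerBlDl.
(* Here the bound [2 C / (n + 1)] is less than 1. *)
have z0 n : (C * 2 <= n)%N -> z n = 0.
  move=> Cn; apply/eqP; rewrite -normr_eq0 -[_ == _]negbK; apply/negP => zn.
  have : 1 <= `|z n| by rewrite -gtz0_ge1 normr_gt0 -normr_eq0.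
  rewrite -(ler_int R) intr_norm => /le_trans /(_ (z_small n)).
  rewrite mulrA ler_pdivlMr ?ltr0n // mul1r -natrM ler_nat.
  by rewrite ltnNge Cn.
have zS n : z n.+1 = n.+1%:Z * z n + \sum_(p <- l) p.1 * (branch p.2 n.+1)%:Z.
  rewrite /z mulr_sumr -big_split /=; apply: eq_bigr => p _.
  by rewrite PoszD PoszM mulrDr mulrCA.
(* At this index only the branch of [g] has digit 1, so the coefficient of the series is the
   collected coefficient of [g]. Starting at [(C * 2).+1] makes both [z n] and [z n.+1] vanish. *)
have [[//|n] nC nP] := branch_far (map snd l) g (C * 2).+1.
have := zS n; rewrite !z0 ?(leq_trans _ nC) // mulr0 add0r => E; rewrite [RHS]E.
rewrite big_mkcond /= [LHS]big_seq [RHS]big_seq; apply: eq_bigr => p lp.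
by rewrite nP ?map_f //; case: eqP; rewrite ?mulr1 ?mulr0.
Qed.

Lemma branch_value_free l : lin branch_value l = 0 -> forall g, coef l g = 0.
Proof.
move=> l0 g; have [D [l' [D0 lE]]] := integral_comb l.
have D0' : D%:~R != 0 :> rat by rewrite intr_eq0.
apply: (mulfI D0'); rewrite mulr0 -coef_scale lE /coef big_map /= -rmorph_sum /=.
rewrite integral_branch_comb ?rmorph0 //.
have := congr1 (fun x => D%:~R *: x) l0.
rewrite -lin_scale lE scaler0 /lin big_map /=.
move=> E; apply: etrans E; apply: eq_bigr => p _.
by rewrite /GRing.scale /= /ratscale ratr_int.
Qed.

Lemma branch_value_inj : injective branch_value.
Proof.
move=> f g fg; have [//|/eqP nfg] := pselect (f = g).
have := @branch_value_free [:: (1, f); (-1, g)] _ f.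
rewrite lin_cons lin_cons lin_nil fg addr0 scale1r scaleN1r subrr => /(_ erefl).
by rewrite /coef !big_cons big_nil /= eqxx eq_sym (negPf nfg).
Qed.

End IndependentReals.

(** * Free groups *)

Section FreeGroup.
Variable C : choiceType.
Local Notation letter := (C * bool)%type.
Implicit Types (l : letter) (s t : seq letter) (c : C) (k : int) (w : seq (C * int)).

Definition flip l : letter := (l.1, ~~ l.2).

Lemma flipK : involutive flip.
Proof. by case=> c b; rewrite /flip negbK. Qed.

Lemma flip_neq l : flip l <> l.
Proof. by case: l => c [] []. Qed.

Definition freely_reduced s := sorted (fun l l' => l' != flip l) s.

(** Left multiplication of a reduced word by a letter. Following van der Waerden, letters permute
    the reduced words, and the product lets the first word act on the second; associativity then
    rests on [foldr_push]. *)
Definition push l s := if s is l' :: s' then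
  if l' == flip l then s' else l :: s else [:: l].

Lemma push_reduced l s : freely_reduced s -> freely_reduced (push l s).
Proof.
case: s => [|l' s] //= red; case: ifP => [_|/= -> //].
exact: path_sorted red.
Qed.

Lemma foldr_push_reduced s t : freely_reduced t -> freely_reduced (foldr push t s).
Proof. by move=> tr; elim: s => //= l s; exact: push_reduced. Qed.

Lemma pushK l s : freely_reduced s -> push (flip l) (push l s) = s.
Proof.
case: s => [|l' s] /=; first by rewrite flipK eqxx.
case: eqP => [-> |_ _] /=; last by rewrite flipK eqxx.
case: s => [|l2 s] //= /andP[+ _].
by rewrite flipK => /negPf ->.
Qed.

Lemma foldr_push_id s : freely_reduced s -> foldr push [::] s = s.
Proof.
elim: s => [|l s IH] //= ls; rewrite IH; last exact: path_sorted ls.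
by case: s ls {IH} => [|l' s] //= /andP[/negPf ->].
Qed.

Lemma foldr_push l s t : freely_reduced t ->
  foldr push t (push l s) = push l (foldr push t s).
Proof.
move=> tr; case: s => [|l' s] //=; case: eqP => [->|//].
by have := @pushK (flip l); rewrite flipK => -> //; exact: foldr_push_reduced.
Qed.

Definition inverse s := rev (map flip s).

Lemma inverseK : involutive inverse.
Proof.
move=> s; rewrite /inverse map_rev revK -map_comp map_id_in // => l _ /=.
by rewrite flipK.
Qed.

Lemma inverse_reduced s : freely_reduced s -> freely_reduced (inverse s).
Proof.
rewrite /freely_reduced rev_sorted sorted_map; apply: sub_sorted => l l' /=.
by rewrite flipK; apply: contraNN => /eqP ->.
Qed.

Lemma foldr_push_inverse s : foldr push s (inverse s) = [::].
Proof.
elim: s => [|l s IH] //.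
by rewrite /inverse /= rev_cons -cats1 foldr_cat /= flipK eqxx.
Qed.

Definition word := {s : seq letter | freely_reduced s}.

HB.instance Definition _ := Choice.on word.

Definition word_one : word := Sub [::] isT.
Definition word_mul (u v : word) : word :=
  Sub _ (foldr_push_reduced (val u) (valP v)).
Definition word_inv (u : word) : word := Sub _ (inverse_reduced (valP u)).

Lemma word_mulA : associative word_mul.
Proof.
move=> u v u'; apply: val_inj => /=; elim: (val u) => //= l s ->.
by rewrite foldr_push //; exact: valP.
Qed.

Lemma word_mul1 : left_id word_one word_mul.
Proof. by move=> u; apply: val_inj. Qed.

Lemma word_mulr1 : right_id word_one word_mul.
Proof. by move=> u; apply: val_inj; exact/foldr_push_id/valP. Qed.

Lemma word_mulV : left_inverse word_one word_inv word_mul.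
Proof. by move=> u; apply: val_inj; exact: foldr_push_inverse. Qed.

Lemma word_mulrV : right_inverse word_one word_inv word_mul.
Proof.
move=> u; apply: val_inj => /=; rewrite -{2}[val u]inverseK.
exact: foldr_push_inverse.
Qed.

HB.instance Definition _ := isGroup.Build word
  word_mulA word_mul1 word_mulr1 word_mulV word_mulrV.

Lemma val_mulw (u v : word) : val (u * v)%g = foldr push (val v) (val u).
Proof. by []. Qed.

(* The middle letter, or the two middle letters, of s give a contradiction. *)
Lemma self_inverse s : freely_reduced s -> s = inverse s -> s = [::].
Proof.
case: s => // l0 s0; set s := l0 :: s0 => sred sE; exfalso.
have nthE i : (i < size s)%N -> nth l0 s i = flip (nth l0 s (size s - i.+1)).
  move=> si; rewrite {1}sE /inverse nth_rev size_map // (nth_map l0) //.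
  by rewrite ltn_subrL.
have sz := odd_double_half (size s).
move: (size s)./2 sz => h; rewrite -addnn => sz.
have [odd_s|even_s] := boolP (odd (size s)).
  rewrite odd_s add1n in sz; apply: (@flip_neq (nth l0 s h)).
  by rewrite [in RHS]nthE -sz ?subSS ?addnK // ltnS leq_addr.
rewrite (negPf even_s) add0n in sz; case: h sz => // h sz.
have hs : (h.+1 < size s)%N by rewrite -sz addSn ltnS addnS ltnS leq_addr.
have /eqP[] := sortedP l0 sred h hs.
rewrite [nth l0 s h]nthE ?flipK; last exact: ltnW.
by rewrite -[in RHS]sz addnK.
Qed.

Lemma word_no2 (u : word) : (u * u = 1)%g -> u = 1%g.
Proof.
move=> uu; apply: val_inj; apply: self_inverse; first exact: valP.
have : u = u^-1%g by apply: (mulgI u); rewrite uu mulgV.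
by move/(congr1 val).
Qed.

Definition generator (c : C) : word := Sub [:: (c, true)] isT.

Definition syllable (p : C * int) : seq letter := nseq `|p.2|%N (p.1, 0 <= p.2).

(** Links the words with exponents, in which freeness is stated, to words of letters: it maps the
    reduced ones bijectively onto the freely reduced ones. *)
Definition expand (w : seq (C * int)) : seq letter := flatten (map syllable w).

Lemma val_expgz c k : val (expgz (generator c) k) = syllable (c, k).
Proof.
have E n : val (generator c ^+ n)%g = nseq n (c, true).
  elim: n => [|n IH] //; rewrite expgS val_mulw IH /=.
  by case: n {IH} => //= n; case: eqP => // -[].
case: k => n; first exact: E.
rewrite /expgz /syllable; transitivity (inverse (val (generator c ^+ n.+1)%g)).
  by [].
by rewrite E /inverse map_nseq rev_nseq.
Qed.

Lemma val_word_eval w : val (word_eval generator w) = foldr push [::] (expand w).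
Proof.
rewrite /word_eval; elim: w => [|[c k] w IH]; first by rewrite big_nil.
by rewrite big_cons val_mulw IH val_expgz /expand /= foldr_cat.
Qed.

Lemma expand_head c k w p : reduced ((c, k) :: w) ->
  ohead (expand w) = Some p -> p.1 <> c.
Proof.
case: w => // -[c' k'] w /andP[/= /and3P[_ k'0 _] /andP[cc' _]].
rewrite /expand /= /syllable; case: k' k'0 => [[|n]|n] //= _ [<-] /= E;
  by rewrite E eqxx in cc'.
Qed.

Lemma reduced_behead p w : reduced (p :: w) -> reduced w.
Proof.
rewrite /reduced /= => /andP[/andP[_ ->]] /=; exact: path_sorted.
Qed.

Lemma expand_reduced w : reduced w -> freely_reduced (expand w).
Proof.
elim: w => // -[c k] w IH red; have {IH} := IH (reduced_behead red).
have := expand_head red; rewrite /expand /= -/(expand w) /syllable /=.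
set s := expand w => hs sred; elim: (`|k|%N) => //= n IH.
case: n IH => [_|n] /=; last first.
  by move=> ->; rewrite andbT; case: (0 <= k); apply/eqP => -[].
case: s hs sred => //= p s hs ->; rewrite andbT; apply/eqP => E.
by apply: (hs _ erefl); rewrite E.
Qed.

(** The first syllable is recovered as the maximal initial run of one letter. *)
Lemma nseq_cat_inj l l' n n' s s' : ohead s <> Some l -> ohead s' <> Some l' ->
  nseq n.+1 l ++ s = nseq n'.+1 l' ++ s' -> [/\ l = l', n = n' & s = s'].
Proof.
move=> sl + [ll']; rewrite -{}ll' {l'} => s'l; elim: n n' => [|n IH] [|n'] //=.
- by move=> E; rewrite E in sl.
- by move=> E; rewrite -E in s'l.
by move=> [/IH[_ -> ->]].
Qed.

Lemma expand_cons c k w : k != 0 -> exists2 n, `|k|%N = n.+1 &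
  expand ((c, k) :: w) = (c, 0 <= k) :: nseq n (c, 0 <= k) ++ expand w.
Proof.
rewrite -absz_gt0 /expand /= /syllable /=.
by case: `|k|%N => // n _; exists n.
Qed.

Lemma reduced_head c k w : reduced ((c, k) :: w) -> k != 0.
Proof. by move=> /andP[/andP[]]. Qed.

Lemma expand_inj w w' : reduced w -> reduced w' -> expand w = expand w' -> w = w'.
Proof.
elim: w w' => [|[c k] w IH] [|[c' k'] w'] //.
- by move=> _ /reduced_head /(expand_cons c' w')[n _ ->].
- by move=> /reduced_head /(expand_cons c w)[n _ ->] _.
move=> red red'; have [n kn ->] := expand_cons c w (reduced_head red).
have [n' kn' ->] := expand_cons c' w' (reduced_head red').
move=> /(@nseq_cat_inj _ _ n n')[||[cc' kk'] nn' /IH ->].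
- by move/(expand_head red).
- by move/(expand_head red').
- rewrite cc'; congr ((_, _) :: _); rewrite nn' -kn' in kn.
  case: k k' kk' kn {red red' kn'} => m [] m' //= _.
    by move=> ->.
  by move=> [->].
- exact: reduced_behead red.
- exact: reduced_behead red'.
Qed.

Lemma expand_surj s : freely_reduced s -> exists2 w, reduced w & expand w = s.
Proof.
elim: s => [|[c b] s IH] sred; first by exists [::].
have [w wred ws] := IH (path_sorted sred).
pose e : int := if b then 1 else -1.
(* The new letter either starts a syllable of its own or joins the first one. *)
have [wc|[k [w1 wE]]] : (forall p : C * int, ohead w = Some p -> p.1 <> c) \/
    exists k w1, w = (c, k) :: w1.
- case: w {wred ws} => [|[c' k] w]; first by left.
  have [->|/eqP cc'] := eqVneq c' c; first by right; exists k, w.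
  by left => _ [<-].
- exists ((c, e) :: w); last by rewrite -ws /expand /syllable /e; case: (b).
  move/andP: wred => [wall wsort]; rewrite /reduced /= wall andbT.
  apply/andP; split; first by rewrite /e; case: (b).
  case: w wc {wall ws} wsort => //= p w wc ->; rewrite andbT eq_sym.
  exact/eqP/wc.
rewrite {}wE in wred ws; have k0 := reduced_head wred.
have [n kn wE] := expand_cons c w1 k0.
(* Since the letters do not cancel, the signs agree and the absolute value of the exponent grows by
   one. *)
have kb : (0 <= k) = b.
  move: sred; rewrite -ws wE /= => /andP[+ _].
  by rewrite /flip xpair_eqE eqxx /=; case: (b) (0 <= k) => [] [].
have [ke0 keb ken] : [/\ k + e != 0, (0 <= k + e) = b & `|(k + e)%R|%N = n.+2].
  by rewrite /e -kb; move: kn; case: ifP; split; lia.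
exists ((c, k + e) :: w1); last first.
  by rewrite /expand /= /syllable /= keb ken -ws wE kb.
by move: wred; rewrite /reduced /= k0 ke0; case: (w1).
Qed.

End FreeGroup.

(** * The free group of Hamel bijections *)

Section WellOrder.

Lemma strict_well_order (T : eqType) : exists lt : T -> T -> Prop,
  well_founded lt /\ forall s t, [\/ lt s t, s = t | lt t s].
Proof.
have [le le_wo] := well_ordering_principle T.
have le_chain : wo_chain le predT by move=> A _; exact: le_wo.
exists (fun s t => s <> t /\ le s t); split=> [t|s t]; last first.
  have [->|/eqP st] := eqVneq s t; first by constructor 2.
  have /orP[le_st|le_ts] : le s t || le t s by exact: (wo_chainW le_chain).
    by constructor 1.
  by constructor 3; split=> // ts; apply: st.
apply: contrapT => nt; pose A : {pred T} := [pred t |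
  `[< ~ Acc (fun s t => s <> t /\ le s t) t >]].
have [|m [[/asboolP Am mP] _]] := le_wo A; first by exists t; apply/asboolP.
apply: Am; constructor => s [sm le_sm]; apply: contrapT => ns; apply: sm.
have le_ms : le m s by apply: mP; exact/asboolP.
by apply: (wo_chain_antisymmetric le_chain) => //; rewrite le_sm.
Qed.

(** Lexicographic order with the rank compared first, so that a task comes after all orbits of
    smaller rank. *)
Lemma ranked_well_order (T : eqType) : exists lt : T * nat -> T * nat -> Prop,
  [/\ well_founded lt, forall s t, [\/ lt s t, s = t | lt t s] &
      forall s t, (s.2 < t.2)%N -> lt s t].
Proof.
have [lt [lt_wf lt_total]] := strict_well_order T.
pose lt' (s t : T * nat) := (s.2 < t.2)%N \/ s.2 = t.2 /\ lt s.1 t.1.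
exists lt'; split; last by move=> s t st; left.
- suff H n : forall m x, (m <= n)%N -> Acc lt' (x, m).
    by move=> [x n]; exact: (H n).
  elim: n => [|n IH] m + mn; move=> x; elim: (lt_wf x) => {}x _ IHx;
    constructor=> -[y k] [/= km|[/= -> yx]]; try exact: IHx.
    by move: (leq_trans km mn).
  by apply: IH; rewrite -ltnS (leq_trans km).
- move=> [x m] [y n]; rewrite /lt' /=.
  have [mn|nm|->] := ltngtP m n; [by constructor 1; left|by constructor 3; left|].
  by have [xy|->|yx] := lt_total x y; [constructor 1|constructor 2|constructor 3];
    rewrite //; right.
Qed.

End WellOrder.

HB.instance Definition _ (R : realType) := isPointed.Build (ratmod R) 0.

Section FreeHamelAction.
Variables (R : realType) (F : groupType).
Hypothesis no2 : forall w : F, (w * w = 1 -> w = 1)%g.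
Hypotheses (F_bits : embeds F bits) (bits_F : embeds bits F).
Local Notation I := (R * nat)%type.
Local Notation X := (F * (I * bool))%type.
Local Notation delta := (@delta F (I * bool)%type).

Lemma embeds_points : embeds X bits.
Proof.
apply: embeds_pair => //; apply: embeds_pair; last exact: embeds_count.
by apply: embeds_pair; [exact: embeds_real|exact: embeds_count].
Qed.

Lemma task_enumeration : exists task : R -> F * seq (rat * X),
  forall wl, exists r, task r = wl.
Proof.
have [i i_inj] : embeds (F * seq (rat * X)) R.
  apply: (@embeds_trans _ bits); last first.
    by exists (branch_value R); exact: branch_value_inj.
  apply: embeds_pair => //; apply: embeds_seq.
  by apply: embeds_pair; [exact: embeds_count|exact: embeds_points].
have /choice[task taskP] : forall r, exists wl, (exists wl', i wl' = r) -> i wl = r.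
  move=> r; have [[wl wlr]|nwl] := pselect (exists wl', i wl' = r).
    by exists wl.
  (* Reals outside the range of [i] receive an arbitrary task. *)
  by exists (1%g, [::]).
by exists task => wl; exists (i wl); apply: i_inj; apply: taskP; exists wl.
Qed.

Lemma complementary_kernel : exists K : set (X -> rat^o), [/\ subspace K, good K,
  forall k, K k -> exists l, k = lin delta l,
  forall w l, w <> 1%g ->
    exists k k', [/\ K k, K k' & lin delta l = k + shift w k'] &
  forall l, exists y, K (lin delta l - delta y)].
Proof.
have [lt [lt_wf lt_total lt_rank]] := ranked_well_order R.
have lt_trans := wf_total_trans lt_wf lt_total.
have [task taskP] := task_enumeration.
(* Stage [(r, n)] attempts task [r] only if the orbits in it have rank below [n]; otherwise it
   serves the default task with [wo = 1] and [mo = 0]. *)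
pose ok (t : I) := all (fun p : rat * X => (p.2.2.1.2 < t.2)%N) (task t.1).2.
pose wo t := if ok t then (task t.1).1 else 1%g.
pose mo t := if ok t then lin delta (task t.1).2 else 0.
have mo_supp s t : ~ lt s t -> fresh s (mo t).
  move=> nst g b; rewrite /mo; case: ifP => // /allP okt; rewrite lin_delta /coef.
  rewrite big_seq_cond big1 // => p /andP[/okt /= pt /eqP pE].
  by case: nst; apply: lt_rank; rewrite pE in pt.
have ex w l : exists t, wo t = w /\ mo t = lin delta l.
  (* Each task is attempted at some stage: one more than the largest rank in [l] will do. *)
  have [r rE] := taskP (w, l).
  have okr : ok (r, (\max_(p <- l) p.2.2.1.2).+1).
    rewrite /ok rE; apply/allP => p lp /=; rewrite ltnS.
    by apply: (@leq_bigmax_seq _ l xpredT (fun p => p.2.2.1.2)).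
  by exists (r, (\max_(p <- l) p.2.2.1.2).+1); rewrite /wo /mo okr rE.
exists (kernel wo mo lt_wf setT); split.
- exact: subspace_linspan.
- exact: good_kernel.
- suff : kernel wo mo lt_wf setT `<=` [set k | exists l, k = lin delta l] by [].
  apply: linspan_sub => [|r [t [_ _ rt]]].
    split=> [|a _ _ [l ->] [l' ->]]; first by exists [::]; rewrite lin_nil.
    by exists (scale_comb a l ++ l'); rewrite lin_cat lin_scale.
  have [lm lmE] : exists l, mo t = lin delta l.
    rewrite /mo; case: ifP => _; first by exists (task t.1).2.
    by exists [::]; rewrite lin_nil.
  have dE x : delta x = lin delta [:: (1, x)].
    by rewrite lin_cons lin_nil addr0 scale1r.
  have BE l l' : lin delta l - lin delta l' = lin delta (l ++ scale_comb (-1) l').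
    by rewrite lin_cat lin_scale scaleN1r.
  have [ld ldE] : exists l, (delta2 t : X -> rat^o) = lin delta l.
    by rewrite /delta2 !dE -lin_cat; eexists.
  move: rt; rewrite /rels lmE ldE dE shift_lin !BE.
  by case: ifP => _; [move=> ->|move=> [->|->]]; eexists.
- move=> w l w1; have [t [tw <-]] := ex w l.
  by rewrite -tw; apply: kernel_act; rewrite tw.
- by move=> l; have [t [tw <-]] := ex 1%g l; exact: kernel_delta.
Qed.

(** The quotient by [K] and the reals are matched through bases of equal cardinality: one contains
    all points of the orbits [(t, true)], the other all branch values. *)
Lemma free_hamel_action : exists rho : F -> R -> R,
  [/\ rho 1%g =1 id, forall w w', rho (w * w')%g =1 rho w \o rho w' &
      forall w, w <> 1%g -> hamel_function (rho w)].
Proof.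
have [K [subK [K1 K2 K3] Kfin Kact Kdelta]] := complementary_kernel.
pose A : set X := [set x : X | x.2.2].
have freeA : free_mod delta K A.
  move=> l lA Kl x; rewrite -lin_delta (K3 _ Kl) // => g t.
  rewrite lin_delta /coef big_seq_cond big1 // => p /andP[/lA + /eqP pE].
  by rewrite /A /= pE.
have [B [AB freeB genB]] := maximal_free subK freeA.
pose rid := fun r : ratmod R => r.
have sub0 : subspace [set 0 : ratmod R].
  by split=> // a x y -> ->; rewrite scaler0 addr0.
have freeV : free_mod rid [set 0] (range (@branch_value R)).
  move=> l lV l0 r.
  have [l' lE] : exists l', l = [seq (p.1, branch_value R p.2) | p <- l'].
    elim: l lV {l0} => [|[q s] l IH] lV; first by exists [::].
    have [|l' ->] := IH; first by move=> p lp; apply: lV; rewrite inE lp orbT.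
    have [f _ /= fs] := lV _ (mem_head _ _).
    by exists ((q, f) :: l'); rewrite /= fs.
  have l'0 : lin (@branch_value R) l' = 0.
    by move: l0; rewrite lE /lin big_map.
  have [[f fr]|nf] := pselect (exists f, branch_value R f = r); last first.
    by rewrite lE /coef big_map big1 // => p /eqP pr; case: nf; exists p.2.
  rewrite -(branch_value_free l'0 f) lE /coef big_map; apply: eq_bigl => p /=.
  by rewrite -fr (inj_eq (@branch_value_inj R)).
have [H [VH freeH genH]] := maximal_free sub0 freeV.
have [i i_inj] := bits_F; have [j j_inj] := embeds_points.
have [h h_inj] := embeds_real R.
(* A single orbit marked [true] already has continuum many points. *)
have cardB : (B #= [set: bits])%card.
  apply: (card_eq_inj j_inj (g := fun f => (i f, ((0, 0%N), true)))).
    by move=> f g [/i_inj].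
  by move=> f; apply: AB.
have cardH : (H #= [set: bits])%card.
  apply: (card_eq_inj h_inj (@branch_value_inj R)) => f.
  by apply: VH; exists f.
have /card_set_bijP[theta thetaP] : (B #= H)%card.
  by apply: card_eq_trans cardB _; rewrite card_eq_sym.
have genH' r : exists l, {in l, forall p, H p.2} /\ r = lin rid l.
  by have [l [lH /eqP]] := genH r; rewrite subr_eq0 => /eqP; exists l.
have [phi [psi [phiK psiK phi0]]] :=
  coordinates subK K2 Kdelta freeB genB freeH genH' thetaP.
exists (induced phi psi); split.
- exact: induced1.
- exact: inducedM.
- move=> w w1; split.
    exact: (induced_free K1 psiK phi0 w1).
  exact: (induced_gen subK Kfin Kact phiK psiK phi0 w1).
Qed.

End FreeHamelAction.

(** The span of the diagonal stays in the diagonal and misses [(0, 1)]. This yields faithfulness of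
    the action on the reals. *)
Lemma id_not_hamel (R : realType) : ~ hamel_function (@id R).
Proof.
move=> [_ /seteqP[_ /(_ ((0 : R^o), (1 : R^o)) I)]] [s [c [sG sE]]].
have [] := ratcomb_coords s c; rewrite -sE /= => e0 e1.
have : (0 : R) = 1.
  rewrite [LHS]e0 [RHS]e1 big_seq [RHS]big_seq; apply: eq_bigr => p /sG /= pE.
  by rewrite [X in _ * X = _](esym pE).
by move/eqP; rewrite eq_sym oner_eq0.
Qed.

(** * Words under group homomorphisms *)

Section Transport.
Variables (G H : groupType) (rho : G -> H).
Hypothesis rhoM : forall u v, rho (u * v)%g = (rho u * rho v)%g.

Lemma rho1 : rho 1%g = 1%g.
Proof. by apply: (mulgI (rho 1%g)); rewrite -rhoM !mulg1. Qed.

Lemma rhoV u : rho u^-1%g = (rho u)^-1%g.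
Proof. by apply: (mulgI (rho u)); rewrite -rhoM !mulgV rho1. Qed.

Lemma rho_expgz u k : rho (expgz u k) = expgz (rho u) k.
Proof.
have E n : rho (u ^+ n)%g = (rho u ^+ n)%g.
  by elim: n => [|n IH]; rewrite ?rho1 // !expgS rhoM IH.
by case: k => n; rewrite /expgz ?rhoV E.
Qed.

Lemma rho_word_eval (J : eqType) (x : J -> G) w :
  rho (word_eval x w) = word_eval (rho \o x) w.
Proof.
rewrite /word_eval; elim: w => [|p w IH]; first by rewrite !big_nil rho1.
by rewrite !big_cons rhoM rho_expgz IH.
Qed.

Lemma generated_rho (J : eqType) (x : J -> G) g :
  generated (rho \o x) g -> exists u, g = rho u.
Proof.
move=> /(_ [set g | exists u, g = rho u]); apply; split; last first.
  by move=> _ [j _ <-]; exists (x j).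
split.
- by exists 1%g; rewrite rho1.
- by move=> _ _ [u ->] [v ->]; exists (u * v)%g; rewrite rhoM.
- by move=> _ [u ->]; exists u^-1%g; rewrite rhoV.
Qed.

End Transport.

Lemma generator_normal_form (C : choiceType) (u : word C) :
  exists w, reduced w /\ word_eval (@generator C) w = u.
Proof.
have [w wred wE] := expand_surj (valP u); exists w; split=> //.
by apply: val_inj; rewrite val_word_eval wE foldr_push_id //; exact: valP.
Qed.

Lemma generator_free (C : choiceType) (w w' : seq (C * int)) :
  reduced w -> reduced w' ->
  word_eval (@generator C) w = word_eval (@generator C) w' -> w = w'.
Proof.
move=> wr wr' /(congr1 val); rewrite !val_word_eval.
rewrite !foldr_push_id ?expand_reduced //; exact: expand_inj.
Qed.

Theorem theorem1 (R : realType) (C : eqType) (le : rel C)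
    (leC : is_continuum_ordinal R le) :
  exists f : C -> bijection R,
    [/\ forall b : C, hamel_bijection (f b),
        free_generators f &
        forall g : bijection R,
          generated f g -> g <> 1%g -> hamel_bijection g].
Proof.
have cardC : ([set: C] #= [set: ratmod R])%card by case: leC.
have [i [_ i_inj i_surj]] := elimT card_set_bijP cardC.
have iI : injective i by move=> a b; apply: i_inj; rewrite inE.
have /choice[j jK] : forall r, exists c, i c = r.
  by move=> r; have [c _ <-] := i_surj r I; exists c.
have jI : injective j by exact: can_inj jK.
(* Classical choice equips [C] with a choice structure over its given equality, so words over [C']
   are words over [C]. *)
pose C' : choiceType := HB.pack C (gen_choiceMixin C).
pose F : groupType := word C'.
have F_bits : embeds F bits.
  apply: (@embeds_trans _ (seq (C * bool))); first by exists val; exact: val_inj.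
  apply: embeds_seq; apply: embeds_pair; last exact: embeds_count.
  by apply: embeds_trans (embeds_real R); exists i.
have bits_F : embeds bits F.
  apply: (@embeds_trans _ R).
    by exists (branch_value R); exact: branch_value_inj.
  exists (fun r => @generator C' (j r)) => r s /(congr1 val) /= [].
  exact: jI.
have [rho [rho1 rhoM rhoH]] := free_hamel_action R (@word_no2 C') F_bits bits_F.
have rho_bij w : bijective (rho w).
  by exists (rho w^-1%g) => r; have := rhoM; rewrite /comp /eqfun => <-;
    rewrite ?mulVg ?mulgV rho1.
pose br w : bijection R := Bijection (rho_bij w).
have brM u v : br (u * v)%g = (br u * br v)%g.
  by apply: bijection_eqP => r; exact: rhoM.
have br_hamel u : u <> 1%g -> hamel_bijection (br u).
  by move=> u1; split; [exact: rhoH|exact: rho_bij].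
(* A nontrivial [u] acts by a Hamel function, hence not as the identity: the free group embeds in
   the bijections, and unique reduced forms carry over. *)
have br_ker u : br u = 1%g -> u = 1%g.
  move=> u1; apply: contrapT => /rhoH; have -> : rho u = id.
    by have := congr1 (@bij_fun R) u1.
  exact: id_not_hamel.
have br_inj : injective br.
  move=> u v uv; apply/eqP; rewrite -divg_eq1; apply/eqP/br_ker.
  by rewrite brM uv -brM mulgV; apply: bijection_eqP => r; exact: rho1.
pose f (c : C) := br (@generator C' c).
have evalE w : word_eval f w = br (word_eval (@generator C') w).
  by rewrite (rho_word_eval brM).
have genE g : generated f g -> exists u, g = br u := @generated_rho _ _ _ brM C _ g.
exists f; split.
- by move=> b; apply: br_hamel => /(congr1 val).
- move=> g /genE[u ->]; have [w [wred wu]] := generator_normal_form u.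
  exists w; split; first by rewrite evalE wu.
  move=> w' [w'red]; rewrite evalE => /br_inj w'u.
  by apply: (@generator_free C') => //; rewrite wu.
- move=> g /genE[u ->] u1; apply: br_hamel => uE; apply: u1.
  by rewrite uE; apply: bijection_eqP => r; exact: rho1.
Qed.
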